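(* For each real number $C>0$ there is a compact set $X\subseteq\mathbb{C}$, obtained by deleting from the closed unit disc a countable union of open discs, such that the unit circle $\mathbb{T}$ is a subset of $X$, the uniform algebra $R(X)$ has no non-zero, bounded point derivations, but for all $f,g\in R_0(X)$, $$\left|\int_{\mathbb{T}} f'(z)g(z)\,dz\right|\le C\,|f|_X\,|g|_X .$$
   Context: For a compact set $X\subseteq\mathbb{C}$, $R_0(X)$ denotes the set of restrictions to $X$ of rational functions with poles off $X$, and $R(X)$ is the closure of $R_0(X)$ in $C(X)$ (the algebra of continuous complex-valued functions on $X$) with respect to the uniform norm. For a bounded complex-valued function $f$ on a non-empty set $S$, $|f|_S=\sup\{|f(x)|:x\in S\}$. For $f\in R_0(X)$, $f'$ is the complex derivative of the rational function. $\mathbb{T}=\{z\in\mathbb{C}:|z|=1\}$, with the usual (anticlockwise) orientation in contour integrals. A point derivation on a commutative unital Banach algebra $A$ at a character $\varphi$ of $A$ is a linear functional $d:A\to\mathbb{C}$ with $d(fg)=\varphi(f)d(g)+\varphi(g)d(f)$ for all $f,g\in A$; it is bounded if it is continuous. (The characters of $R(X)$ are exactly the evaluations at points of $X$.) *)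

(* Defs.v *)
From HB Require Import structures.
From mathcomp Require Import all_boot all_order all_algebra.
From mathcomp Require Import all_classical all_reals all_analysis.
From mathcomp.real_closed Require Import complex.

Import Order.TTheory GRing.Theory Num.Theory.
Import numFieldNormedType.Exports.
Import ComplexField.Normc.

Local Open Scope classical_set_scope.
Local Open Scope complex_scope.
Local Open Scope ring_scope.

Section Defs.
Context {R : realType}.
(* R[i] with the topology of its norm is the regular module R[i]^o. *)
Local Notation C := R[i]^o.

(* Moduli are taken in R, as [normc z]; the library norm [`|z|] is R[i]-valued. *)
Definition open_disc (a : C) (r : R) : set C := [set z | normc (z - a) < r].
Definition closed_unit_disc : set C := [set z | normc z <= 1].
Definition unit_circle : set C := [set z | normc z = 1].

Definition unit_disc_minus (D : set (C * R)) : set C :=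
  closed_unit_disc `\` \bigcup_(d in D) open_disc d.1 d.2.

Definition supnorm {T : Type} (S : set T) (f : T -> C) : R :=
  sup [set normc (f x) | x in S].

(* Values at the zeros of q are junk, but these lie off X; every rational
   function with poles off X has such a representation p / q. *)
Definition rational_off (X : set C) : set (C -> C) :=
  [set f | exists p q : {poly R[i]},
     (forall z, X z -> ~~ root q z) /\ f = (fun z => p.[z] / q.[z])].

Definition R0 (X : set C) : set {uniform X -> C} :=
  [set (f \o set_val : X -> C) | f in rational_off X].

Definition CX (X : set C) : set {uniform X -> C} :=
  [set f | continuous (f : X -> C)].

Definition RX (X : set C) : set {uniform X -> C} := CX X `&` closure (R0 X).

Section FunctionAlgebra.
Context {T : choiceType} (A : set {uniform T -> C}).
Implicit Types phi d : {uniform T -> C} -> C.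

(* Functionals on a subalgebra A of C^T are represented by total maps of which
   only the values on A matter. *)
Definition linear_on d : Prop :=
  forall (a : C) (f g : T -> C), A f -> A g ->
    d (fun x => a * f x + g x) = a * d f + d g.

Definition multiplicative_on d : Prop :=
  forall f g : T -> C, A f -> A g -> d (fun x => f x * g x) = d f * d g.

Definition nonzero_on d : Prop := exists2 f, A f & d f != 0.

Definition character_of phi : Prop :=
  [/\ linear_on phi, multiplicative_on phi & nonzero_on phi].

Definition point_derivation_at phi d : Prop :=
  linear_on d /\
  forall f g : T -> C, A f -> A g ->
    d (fun x => f x * g x) = phi f * d g + phi g * d f.

Definition bounded_functional d : Prop := {within A, continuous d}.

Definition no_nonzero_bounded_point_derivation : Prop :=
  ~ exists phi d, [/\ character_of phi, point_derivation_at phi d,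
                      bounded_functional d & nonzero_on d].

End FunctionAlgebra.

Definition complex_integral (a b : R) (h : R -> C) : C :=
  (\int[lebesgue_measure]_(t in `[a, b]) complex.Re (h t)) +i*
  (\int[lebesgue_measure]_(t in `[a, b]) complex.Im (h t)).

(* z = cos t + i sin t for 0 <= t <= 2 pi, so dz = (- sin t + i cos t) dt. *)
Definition circle_integral (h : C -> C) : C :=
  complex_integral 0 (2 * pi)
    (fun t => h (cos t +i* sin t) * (- sin t +i* cos t)).

Definition cderiv (f : C -> C) : C -> C := derive1 f.

End Defs.

(* Main.v *)
(**
Write [X] as the closed disc minus open discs D(a_n, r_n).

Integral bound. Split rational f = f0 + f1, where f0 is holomorphic on the closed
disc and f1 has its poles in the removed discs and vanishes at infinity; likewise g.
Then the integral of f' g over the circle equals that of f0' g - f g0', which by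
residues is a sum of integrals over the boundaries of the removed discs. Cauchy's
formula for f0' on the unit circle gives |f0'(w)| <= |f|_X / (1 - |w|)^2, so the
whole is O(|f|_X |g|_X sum r_n / (1 - |a_n|)^2). Only finitely many discs matter, by
compactness. Overlapping ones are merged into the disc of radius r + s centred at
the barycentre (r a + s b) / (r + s); by convexity of x^-2 this does not increase
the sum of the weights r / (1 - |a|)^2.

Derivations. A bounded point derivation lives at some z in [X] and bounds |f'(z)| by
|f|_X on rational f. For |z| = 1 the peaking polynomials ((1 + conj(z) x) / 2)^n
exclude this. For |z| < 1 remove, at stage k, discs of radius r = eps_k / N_k^2 around
the points of the lattice of mesh 1 / N_k in |a| <= 1 - 2^-k, so that the total weight
is O(4^k eps_k). A sum of u_a r / (x - a), |u_a| = 1, over an M x M block of the lattice,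
M = 2^-k N_k, with a corner at z, is bounded by 9 on [X], while the u_a can be chosen to
make its derivative at z as large as sum r / |z - a|^2, of order eps_k log M. So eps_k
may be summable as fast as desired provided M is then chosen large enough.
*)
Require Import Defs.
From HB Require Import structures.
From mathcomp Require Import all_boot all_order all_algebra.
From mathcomp Require Import all_classical all_reals all_analysis.
From mathcomp.real_closed Require Import complex.
From mathcomp Require Import ring lra zify.
Import Order.TTheory GRing.Theory Num.Theory.
Import numFieldNormedType.Exports.
Import ComplexField.Normc.
Local Open Scope classical_set_scope.
Local Open Scope complex_scope.
Local Open Scope ring_scope.


(** * Complex-valued integrals over the circle *)

Section modulus.
Set Implicit Arguments.
Unset Strict Implicit.
Context {R : realType}.
Local Notation C := R[i]^o.
Local Notation Re := (@complex.Re R).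
Local Notation Im := (@complex.Im R).
Implicit Types (z w : C) (r : R).

Lemma normc_ge0 z : 0 <= normc z.
Proof. by case: z => a b; rewrite /= sqrtr_ge0. Qed.

Lemma normc_norm z : `|z| = (normc z)%:C.
Proof. by []. Qed.

Lemma normcD z w : normc (z + w) <= normc z + normc w.
Proof. exact: le_normcD. Qed.

Lemma normcB z w : normc (z - w) <= normc z + normc w.
Proof. by rewrite -(normcN w); exact: le_normcD. Qed.

Lemma normc_distC z w : normc (z - w) = normc (w - z).
Proof. by rewrite -normcN opprB. Qed.

Lemma normc_tri z v w : normc (z - w) <= normc (z - v) + normc (v - w).
Proof. by rewrite (le_trans _ (normcD _ _))// addrA subrK. Qed.

Lemma normc_eq0 z : (normc z == 0) = (z == 0).
Proof.
by apply/eqP/eqP => [/eq0_normc//|->]; exact: normc0.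
Qed.

Lemma normc_gt0 z : (0 < normc z) = (z != 0).
Proof. by rewrite lt_def normc_ge0 andbT normc_eq0. Qed.

Lemma normc_real r : normc (r%:C : C) = `|r|.
Proof. by rewrite /= expr0n addr0 sqrtr_sqr. Qed.

Lemma normcX z n : normc (z ^+ n) = normc z ^+ n.
Proof. by elim: n => [|n ih]; rewrite ?expr0 ?normc1// !exprS normcM ih. Qed.

Lemma Re_le_normc z : `|Re z| <= normc z.
Proof.
case: z => a b /=; rewrite -[leLHS]sqrtr_sqr sqrtr_sqr.
by rewrite -sqrtr_sqr ler_sqrt ?addr_ge0 ?sqr_ge0// lerDl sqr_ge0.
Qed.

Lemma Im_le_normc z : `|Im z| <= normc z.
Proof.
case: z => a b /=.
by rewrite -sqrtr_sqr ler_sqrt ?addr_ge0 ?sqr_ge0// lerDr sqr_ge0.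
Qed.

Lemma normc_le_ReIm z : normc z <= `|Re z| + `|Im z|.
Proof.
case: z => a b /=.
rewrite -[leRHS]ger0_norm ?addr_ge0// -sqrtr_sqr ler_sqrt ?sqr_ge0//.
rewrite sqrrD !real_normK ?num_real// lerD2r lerDl.
by rewrite mulrn_wge0// mulr_ge0.
Qed.

Lemma normc_sqr z : normc z ^+ 2 = Re z ^+ 2 + Im z ^+ 2.
Proof. by case: z => a b /=; rewrite sqr_sqrtr// addr_ge0 ?sqr_ge0. Qed.

Lemma normc_conj z : (normc z ^+ 2)%:C = z * (z^*)%C :> C.
Proof.
rewrite normc_sqr; case: z => a b; apply/eqP; rewrite eq_complex /=.
by apply/andP; split; apply/eqP; ring.
Qed.

Lemma normc_conjC z : normc (z^*)%C = normc z.
Proof. by case: z => a b /=; rewrite sqrrN. Qed.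

Lemma Re_add z w : Re (z + w) = Re z + Re w. Proof. by case: z w => [a b] []. Qed.
Lemma Im_add z w : Im (z + w) = Im z + Im w. Proof. by case: z w => [a b] []. Qed.
Lemma Re_mul z w : Re (z * w) = Re z * Re w - Im z * Im w.
Proof. by case: z w => [a b] []. Qed.
Lemma Im_mul z w : Im (z * w) = Re z * Im w + Im z * Re w.
Proof. by case: z w => [a b] [c d] /=; rewrite addrC. Qed.
Lemma Re_inv z : Re z^-1 = Re z / (Re z ^+ 2 + Im z ^+ 2).
Proof. by case: z. Qed.
Lemma Im_inv z : Im z^-1 = - (Im z / (Re z ^+ 2 + Im z ^+ 2)).
Proof. by case: z. Qed.

Lemma complex_eta z : z = Re z +i* Im z. Proof. by case: z. Qed.

End modulus.

Section complex_integral.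
Set Implicit Arguments.
Unset Strict Implicit.
Context {R : realType}.
Local Notation C := R[i]^o.
Local Notation Re := (@complex.Re R).
Local Notation Im := (@complex.Im R).

Definition ccont (g : R -> C) : Prop :=
  continuous (fun t : R => Re (g t) : R) /\ continuous (fun t : R => Im (g t) : R).

Lemma ccontD g h : ccont g -> ccont h -> ccont (fun t => g t + h t).
Proof.
move=> [g1 g2] [h1 h2]; split => t.
  under eq_fun do rewrite Re_add.
  by apply: cvgD; [exact: g1|exact: h1].
under eq_fun do rewrite Im_add.
by apply: cvgD; [exact: g2|exact: h2].
Qed.

Lemma ccontM g h : ccont g -> ccont h -> ccont (fun t => g t * h t).
Proof.
move=> [g1 g2] [h1 h2]; split => t.
  under eq_fun do rewrite Re_mul.
  by apply: cvgB; apply: cvgM; [exact: g1|exact: h1|exact: g2|exact: h2].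
under eq_fun do rewrite Im_mul.
by apply: cvgD; apply: cvgM; [exact: g1|exact: h2|exact: g2|exact: h1].
Qed.

Lemma ccont_cst (c : C) : ccont (fun=> c).
Proof. by split => t; exact: cvg_cst. Qed.

Lemma ccontV g : (forall t, g t != 0) -> ccont g -> ccont (fun t => (g t)^-1).
Proof.
move=> g0 [g1 g2].
have n0 t : Re (g t) ^+ 2 + Im (g t) ^+ 2 != 0.
  by rewrite -normc_sqr sqrf_eq0 normc_eq0.
have cn : continuous (fun t : R => Re (g t) ^+ 2 + Im (g t) ^+ 2).
  by move=> t; apply: cvgD; apply: cvgM; (exact: g1 || exact: g2).
split => t.
  under eq_fun do rewrite Re_inv.
  by apply: cvgM; [exact: g1|apply: cvgV; [exact: n0|exact: cn]].
under eq_fun do rewrite Im_inv.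
apply: cvgN.
by apply: cvgM; [exact: g2|apply: cvgV; [exact: n0|exact: cn]].
Qed.

Let mu := @lebesgue_measure R.

Lemma cont_integrable (f : R -> R) (a b : R) : continuous f ->
  mu.-integrable `[a, b] (EFin \o f).
Proof.
move=> cf; apply: continuous_compact_integrable; first exact: segment_compact.
exact: continuous_subspaceT.
Qed.

Lemma complex_integralD a b g h : ccont g -> ccont h ->
  complex_integral a b (fun t => g t + h t) =
  complex_integral a b g + complex_integral a b h.
Proof.
move=> [g1 g2] [h1 h2]; rewrite /complex_integral.
under eq_Rintegral do rewrite Re_add.
under [X in _ +i* X]eq_Rintegral do rewrite Im_add.
by rewrite !RintegralD//; exact: cont_integrable.
Qed.

Lemma complex_integralZ a b (c : C) g : ccont g ->
  complex_integral a b (fun t => c * g t) = c * complex_integral a b g.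
Proof.
move=> [g1 g2]; rewrite /complex_integral.
under eq_Rintegral do rewrite Re_mul -mulNr.
under [X in _ +i* X]eq_Rintegral do rewrite Im_mul.
have i1 := @cont_integrable _ a b g1.
have i2 := @cont_integrable _ a b g2.
have cZ (k : R) f : continuous f -> mu.-integrable `[a, b] (EFin \o (fun t : R => k * f t)).
  move=> cf; apply: cont_integrable => t.
  by apply: cvgM; [exact: cvg_cst|exact: cf].
rewrite !RintegralD//; try exact: cZ.
rewrite !RintegralZl//.
by rewrite [in RHS](complex_eta c); congr (_ +i* _); rewrite /= ?mulNr// addrC.
Qed.

(** Multiplying by the unimodular [u] with [u * v = |v|] makes the integral [v] real and
    non-negative, so only a real part has to be estimated and no constant factor is lost. *)
Lemma normc_complex_integral a b g (B : R) : a <= b -> ccont g ->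
  (forall t, a <= t <= b -> normc (g t) <= B) ->
  normc (complex_integral a b g) <= (b - a) * B.
Proof.
move=> ab cg gB; set v := complex_integral a b g.
have B0 : 0 <= B by rewrite (le_trans (normc_ge0 (g a))) ?gB ?lexx.
have [v0|v0] := eqVneq v 0.
  by rewrite v0 normc0 mulr_ge0// subr_ge0.
pose u : C := (v^*)%C / (normc v)%:C.
have nv0 : normc v != 0 by rewrite normc_eq0.
have nv0c : (normc v)%:C != 0 :> C by rewrite (inj_eq (@complexI _)).
have u1 : normc u = 1.
  by rewrite normcM normcV normc_real normc_conjC ger0_norm ?normc_ge0// divff.
have uv : u * v = (normc v)%:C.
  rewrite /u mulrAC [_ * v]mulrC -normc_conj expr2 rmorphM /=.
  by rewrite -mulrA divff// mulr1.
have cug : ccont (fun t => u * g t) by apply: ccontM => //; exact: ccont_cst.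
have : Re (complex_integral a b (fun t => u * g t)) = normc v.
  by rewrite complex_integralZ// -/v uv.
move=> <- /=.
apply: (@le_trans _ _ (\int[mu]_(t in `[a, b]) B)).
  apply: le_Rintegral => //.
  - exact: cont_integrable cug.1.
  - by apply: cont_integrable => t; exact: cvg_cst.
  move=> t /=; rewrite in_itv /= => tab; apply: le_trans (ler_norm _) _.
  by apply: le_trans (Re_le_normc _) _; rewrite normcM u1 mul1r gB.
rewrite Rintegral_cst//.
rewrite [X in fine X](_ : _ = (b - a)%:E); last first.
  apply: etrans (lebesgue_measure_itv `[a, b]) _; rewrite /= lte_fin.
  by case: ltgtP ab => // -> _; rewrite subrr.
by rewrite /= mulrC.
Qed.

Definition expi (t : R) : C := cos t +i* sin t.

Lemma expiD s t : expi (s + t) = expi s * expi t.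
Proof. by rewrite /expi cosD sinD; apply/eqP; rewrite eq_complex /= eqxx/=; apply/eqP; ring. Qed.

Lemma expi0 : expi 0 = 1.
Proof. by rewrite /expi cos0 sin0. Qed.

Lemma normc_expi t : normc (expi t) = 1.
Proof. by rewrite /= cos2Dsin2 sqrtr1. Qed.

Lemma ccont_expi k : ccont (fun t => expi (k * t)).
Proof.
have c : continuous (fun t : R => k * t).
  by move=> t; apply: cvgM; [exact: cvg_cst|exact: cvg_id].
by split => t /=; apply: continuous_comp; [exact: c|exact: continuous_cos|
  exact: c|exact: continuous_sin].
Qed.

Lemma expi_nat t n : expi t ^+ n = expi (n%:R * t).
Proof.
elim: n => [|n ih]; first by rewrite mul0r expi0.
by rewrite exprS ih -expiD -natr1 mulrDl mul1r addrC.
Qed.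

Lemma expiN t : expi (- t) = (expi t)^-1.
Proof.
have e0 : expi t != 0 by rewrite -normc_eq0 normc_expi oner_neq0.
by apply: (mulfI e0); rewrite -expiD subrr expi0 divff.
Qed.

Lemma FTC_smooth (f F : R -> R) (a b : R) : a < b -> continuous f ->
  (forall t : R, is_derive t (1 : R) F (f t)) -> \int[mu]_(t in `[a, b]) f t = F b - F a.
Proof.
move=> ab cf dF.
have cF : continuous F.
  by move=> t; apply/differentiable_continuous/derivable1_diffP; case: (dF t).
rewrite /Rintegral (@continuous_FTC2 _ f F)//.
- exact: continuous_subspaceT.
- split; first by move=> t _; case: (dF t).
    exact: cvg_at_right_filter (cF a).
  exact: cvg_at_left_filter (cF b).
- by move=> t _; rewrite derive1E; case: (dF t).
Qed.

(** The antiderivatives [sin (k t) / k] and [- cos (k t) / k] take equal values at both ends by the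
    period hypothesis. *)
Lemma complex_integral_expi (k : R) : k != 0 -> expi (k * (2 * pi)) = 1 ->
  complex_integral 0 (2 * pi) (fun t => expi (k * t)) = 0.
Proof.
move=> k0 [c1 s0]; have pi2 : 0 < 2 * pi :> R by rewrite mulr_gt0// pi_gt0.
have [c s] := ccont_expi k.
rewrite /complex_integral.
have dk t : is_derive t (1:R) (fun t : R => k * t) k.
  by apply: is_derive_eq; rewrite /= scaler1.
have dc t : is_derive t (1:R) (fun t : R => k^-1 * sin (k * t)) (cos (k * t)).
  have := is_deriveZ k^-1 (is_derive1_comp (is_derive_sin (k * t)) (dk t)).
  by move/(@trigger_derive _); apply; rewrite /GRing.scale /= mulrCA mulVf ?mulr1.
have ds t : is_derive t (1:R) (fun t : R => - k^-1 * cos (k * t)) (sin (k * t)).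
  have := is_deriveZ (- k^-1) (is_derive1_comp (is_derive_cos (k * t)) (dk t)).
  by move/(@trigger_derive _); apply; rewrite /GRing.scale /= !mulNr mulrN opprK mulrCA mulVf ?mulr1.
rewrite (FTC_smooth pi2 c dc) (FTC_smooth pi2 s ds).
by rewrite /= !mulr0 sin0 cos0 c1 s0 !subrr.
Qed.

End complex_integral.

(** * Integrals of powers of [z] over the unit circle *)

Section circle_integral.
Set Implicit Arguments.
Unset Strict Implicit.
Context {R : realType}.
Local Notation C := R[i]^o.
Local Notation J := (@circle_integral R).
Implicit Types (f g h : C -> C) (c p : C).

Lemma complex_integral_bounded (g : R -> C) : ccont g ->
  exists B : R, forall t, 0 <= t <= 2 * pi -> normc (g t) <= B.
Proof.
move=> [g1 g2].
have pi2 : (0:R) <= 2 * pi by rewrite mulr_ge0// pi_ge0.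
have bd (u : R -> R) : continuous u ->
    exists B, forall t, 0 <= t <= 2 * pi -> `|u t| <= B.
  move=> cu.
  have cn : {within `[0, 2 * pi]%classic, continuous (fun t => `|u t|)}.
    apply: continuous_subspaceT => t.
    by apply: continuous_comp; [exact: cu|exact: norm_continuous].
  by have [m _ hm] := EVT_max pi2 cn; exists `|u m| => t t02; apply: hm; rewrite in_itv.
have [B1 hB1] := bd _ g1; have [B2 hB2] := bd _ g2.
exists (B1 + B2) => t t02; apply: le_trans (normc_le_ReIm _) _.
by apply: lerD; [exact: hB1|exact: hB2].
Qed.

(** Continuity is asked only along the circle: elsewhere a rational function may have poles, where
    the total map takes default values. *)
Definition circle_cont f : Prop := ccont (fun t : R => f (expi t)).

Lemma circle_integralE f : J f =
  complex_integral 0 (2 * pi) (fun t => 'i * (f (expi t) * expi t)).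
Proof.
congr complex_integral; apply/funext => t.
rewrite mulrCA; congr (_ * _); rewrite /expi.
by apply/eqP; rewrite eq_complex /= !mul0r !mul1r ?add0r ?sub0r ?addr0 !eqxx.
Qed.

Lemma expi_neq0 t : expi t != 0 :> C.
Proof. by rewrite -normc_eq0 normc_expi oner_neq0. Qed.

Lemma ccont_expi1 : ccont (@expi R).
Proof.
by have := ccont_expi (1 : R); rewrite /ccont; under eq_fun do rewrite mul1r;
  under [X in _ /\ continuous X]eq_fun do rewrite mul1r.
Qed.

Lemma circle_cont_eq f g : (forall z : C, normc z = 1 -> f z = g z) ->
  circle_cont g -> circle_cont f.
Proof.
move=> fg; rewrite /circle_cont; suff -> : (fun t => g (expi t)) = (fun t => f (expi t)) by [].
by apply/funext => t; rewrite fg// normc_expi.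
Qed.

Lemma eq_circle_integral f g : (forall z : C, normc z = 1 -> f z = g z) -> J f = J g.
Proof.
move=> fg; rewrite !circle_integralE; congr complex_integral.
by apply/funext => t; rewrite fg// normc_expi.
Qed.

Lemma circle_contD f g : circle_cont f -> circle_cont g ->
  circle_cont (fun z => f z + g z).
Proof. exact: ccontD. Qed.

Lemma circle_contM f g : circle_cont f -> circle_cont g ->
  circle_cont (fun z => f z * g z).
Proof. exact: ccontM. Qed.

Lemma circle_cont_cst c : circle_cont (fun=> c).
Proof. exact: ccont_cst. Qed.

Lemma circle_cont_id : circle_cont id.
Proof. exact: ccont_expi1. Qed.

Lemma circle_contV f : (forall z, normc z = 1 -> f z != 0) -> circle_cont f ->
  circle_cont (fun z => (f z)^-1).
Proof. by move=> f0; apply: ccontV => t; rewrite f0// normc_expi. Qed.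

Lemma circle_contX f n : circle_cont f -> circle_cont (fun z => f z ^+ n).
Proof.
move=> cf; elim: n => [|n ih]; first exact: (circle_cont_cst 1).
apply: (@circle_cont_eq _ (fun z => f z * f z ^+ n)) => [z _|]; first by rewrite exprS.
exact: circle_contM.
Qed.

Lemma unit_neq0 (z : C) : normc z = 1 -> z != 0.
Proof. by rewrite -normc_eq0 => ->; rewrite oner_neq0. Qed.

Lemma circle_cont_inv : circle_cont (fun z => z^-1).
Proof. by apply: circle_contV; [exact: unit_neq0|exact: circle_cont_id]. Qed.

Let ccont_aux f : circle_cont f -> ccont (fun t => 'i * (f (expi t) * expi t)).
Proof.
move=> cf; apply: ccontM; first exact: ccont_cst.
by apply: ccontM; [exact: cf|exact: ccont_expi1].
Qed.

Lemma circle_integralD f g : circle_cont f -> circle_cont g ->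
  J (fun z => f z + g z) = J f + J g.
Proof.
move=> cf cg; rewrite !circle_integralE -complex_integralD; try exact: ccont_aux.
by congr complex_integral; apply/funext => t; rewrite mulrDl mulrDr.
Qed.

Lemma circle_integralZ c f : circle_cont f -> J (fun z => c * f z) = c * J f.
Proof.
move=> cf; rewrite !circle_integralE -complex_integralZ; try exact: ccont_aux.
by congr complex_integral; apply/funext => t; rewrite -mulrA mulrCA.
Qed.

Lemma normc_circle_integral f (B : R) : circle_cont f ->
  (forall z, normc z = 1 -> normc (f z) <= B) -> normc (J f) <= 2 * pi * B.
Proof.
move=> cf fB; rewrite circle_integralE.
have := @normc_complex_integral R 0 (2 * pi) _ B _ (ccont_aux cf).
rewrite subr0; apply; first by rewrite mulr_ge0// pi_ge0.
move=> t _; rewrite !normcM normc_expi mulr1.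
by rewrite [normc 'i]/= expr0n expr1n add0r sqrtr1 mul1r fB// normc_expi.
Qed.

Lemma circle_integral_X n : J (fun z => z ^+ n) = 0.
Proof.
rewrite circle_integralE complex_integralZ; last first.
  by apply: ccontM; [apply: (@circle_contX id); exact: circle_cont_id|exact: ccont_expi1].
rewrite [X in _ * X](_ : _ = 0) ?mulr0//.
under [X in complex_integral _ _ X]eq_fun do rewrite -exprSr expi_nat.
rewrite complex_integral_expi//.
rewrite -expi_nat [expi _](_ : _ = 1) ?expr1n//.
by rewrite mulrC mulr_natr /expi cos2pi sin2pi.
Qed.

Lemma circle_integral_VX n : J (fun z => z^-1 ^+ n.+2) = 0.
Proof.
rewrite circle_integralE complex_integralZ; last first.
  apply: ccontM; last exact: ccont_expi1.
  exact: (@circle_contX (fun z => z^-1) n.+2 circle_cont_inv).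
rewrite [X in _ * X](_ : _ = 0) ?mulr0//.
have e t : (expi t : C)^-1 ^+ n.+2 * expi t = expi ((- n.+1%:R) * t).
  rewrite exprSr -mulrA mulVf ?expi_neq0// mulr1.
  by rewrite -expiN expi_nat mulrN mulNr.
under [X in complex_integral _ _ X]eq_fun do rewrite e.
rewrite complex_integral_expi//.
rewrite mulNr expiN -expi_nat [expi _](_ : _ = 1) ?expr1n ?invr1//.
by rewrite mulrC mulr_natr /expi cos2pi sin2pi.
Qed.

Lemma circle_integral_V : J (fun z => z^-1) = (2 * pi)%:C * 'i.
Proof.
rewrite circle_integralE.
under [X in complex_integral _ _ X]eq_fun do rewrite mulVf ?expi_neq0// mulr1.
rewrite /complex_integral /=.
rewrite !Rintegral_cst//.
rewrite [X in fine X](_ : _ = (2 * pi)%:E); last first.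
  apply: etrans (lebesgue_measure_itv `[0, 2 * pi]) _; rewrite /= lte_fin.
  by rewrite mulr_gt0 ?pi_gt0//= oppr0 addr0.
by apply/eqP; rewrite eq_complex /= !(mul0r,mulr0,mul1r,mulr1,subrr,oppr0,add0r,addr0,sub0r) ?eqxx.
Qed.

End circle_integral.

(** * Laurent coefficients on the unit circle *)

Section moments.
Set Implicit Arguments.
Unset Strict Implicit.
Context {R : realType}.
Local Notation C := R[i]^o.
Local Notation J := (@circle_integral R).
Implicit Types (f g h : C -> C) (c p : C).

(* On functions holomorphic off a compact subset of the open unit disc, [decays k]
   says [f z = O(z ^- k)] at infinity, as far as the coefficients of [z ^ m] with
   [m >= -1] can tell; [holo_moments] says that [f] extends holomorphically to the
   disc. *)
Definition decays (k : nat) f : Prop := circle_cont f /\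
  forall j, (1 < j + k)%N -> J (fun z => z^-1 ^+ j * f z) = 0.

Definition holo_moments f : Prop := circle_cont f /\
  forall j, J (fun z => z ^+ j * f z) = 0.

(** [B] does not depend on [g]: with [g] a power of [z], one constant bounds all Laurent
    coefficients of [f], as the iterations for [f z / (z - p)] require. *)
Lemma circle_cont_bounded f : circle_cont f ->
  exists B : R, forall g : C -> C, circle_cont g -> (forall z, normc z = 1 -> normc (g z) = 1) ->
  normc (J (fun z => g z * f z)) <= B.
Proof.
move=> cf; have [B hB] := complex_integral_bounded cf.
exists (2 * pi * B) => g cg g1; rewrite circle_integralE.
have cgf : ccont (fun t => 'i * ((g (expi t) * f (expi t)) * expi t)).
  apply: ccontM; first exact: ccont_cst.
  by apply: ccontM; [exact: ccontM|exact: ccont_expi1].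
have := @normc_complex_integral R 0 (2 * pi) _ B _ cgf.
rewrite subr0; apply; first by rewrite mulr_ge0// pi_ge0.
move=> t t02; rewrite !normcM normc_expi mulr1 g1 ?normc_expi// mul1r.
by rewrite [normc 'i]/= expr0n expr1n add0r sqrtr1 mul1r; exact: hB.
Qed.

Lemma geometric_eq0 (x q B : R) : 0 <= x -> 0 <= q < 1 ->
  (forall n, x <= q ^+ n * B) -> x = 0.
Proof.
move=> x0 /andP[q0 q1] h; apply/le_anti/andP; split => //.
have : (fun n => q ^+ n * B) @ \oo --> (0 * B : R).
  by apply: cvgM; [apply: cvg_expr; rewrite ger0_norm|exact: cvg_cst].
rewrite mul0r => /cvg_lim <-//; apply: limr_ge.
  apply: is_cvgM; last exact: is_cvg_cst.
  by apply/cvg_ex; exists 0; apply: cvg_expr; rewrite ger0_norm.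
by apply: nearW => n; exact: h.
Qed.

Lemma inner_neq (p z : C) : normc p < 1 -> normc z = 1 -> z - p != 0.
Proof.
by move=> p1 z1; rewrite subr_eq0; apply/negP => /eqP zp; rewrite -zp z1 ltxx in p1.
Qed.

Lemma outer_neq (p z : C) : 1 < normc p -> normc z = 1 -> z - p != 0.
Proof.
by move=> p1 z1; rewrite subr_eq0; apply/negP => /eqP zp; rewrite -zp z1 ltxx in p1.
Qed.

Lemma circle_cont_divB f p : circle_cont f -> normc p != 1 ->
  circle_cont (fun z => f z / (z - p)).
Proof.
move=> cf p1; apply: circle_contM => //; apply: circle_contV.
  by move=> z z1; rewrite subr_eq0; apply: contraNN p1 => /eqP <-; exact/eqP.
by apply: circle_contD; [exact: circle_cont_id|exact: circle_cont_cst].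
Qed.

Lemma circle_contVX j : circle_cont (fun z : C => z^-1 ^+ j).
Proof. exact: (@circle_contX _ (fun z => z^-1) j circle_cont_inv). Qed.

Lemma circle_contXn j : circle_cont (fun z : C => z ^+ j).
Proof. exact: (@circle_contX _ id j circle_cont_id). Qed.

(* The coefficients of [f z / (z - p)] satisfy [a_j = p * a_(j+1)] and are bounded,
   hence vanish. *)
Lemma decays_div k f p : normc p < 1 -> decays k f ->
  decays k.+1 (fun z => f z / (z - p)).
Proof.
move=> p1 [cf Jf]; have cF := circle_cont_divB cf (negbT (lt_eqF p1)).
split=> // j jk; set F := fun z => _.
have step n : J (fun z => z^-1 ^+ (j + n) * (f z / (z - p))) =
    p * J (fun z => z^-1 ^+ (j + n.+1) * (f z / (z - p))).
  rewrite -circle_integralZ; last by apply: circle_contM => //; exact: circle_contVX.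
  rewrite -[RHS]add0r -(Jf (j + n.+1)%N); last by lia.
  rewrite -circle_integralD; last 2 first.
  - by apply: circle_contM => //; exact: circle_contVX.
  - apply: circle_contM; first exact: circle_cont_cst.
    by apply: circle_contM => //; exact: circle_contVX.
  apply: eq_circle_integral => z z1.
  have zp := inner_neq p1 z1; have z0 := unit_neq0 z1.
  by rewrite addnS exprSr; field; rewrite zp z0.
have iter n : J F = p ^+ n * J (fun z => z^-1 ^+ (j + n) * (f z / (z - p))).
  elim: n => [|n ->]; first by rewrite expr0 mul1r addn0.
  by rewrite step exprSr mulrA.
have [B hB] := circle_cont_bounded cF.
apply: eq0_normc; apply: (@geometric_eq0 _ (normc p) B); rewrite ?normc_ge0//.
move=> n; rewrite (iter n) normcM normcX ler_wpM2l ?exprn_ge0 ?normc_ge0//.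
apply: hB; first exact: circle_contVX.
by move=> z z1; rewrite normcX normcV z1 invr1 expr1n.
Qed.

Lemma decays1 : decays 0 (fun=> 1).
Proof.
split; first exact: circle_cont_cst.
move=> [|[|j]]// _; under eq_fun do rewrite mulr1.
exact: circle_integral_VX.
Qed.

Lemma decaysS k f : decays k.+1 f -> decays k f.
Proof. by move=> [cf h]; split => // j jk; apply: h; rewrite addnS ltnW. Qed.

Lemma decaysD k f g : decays k f -> decays k g -> decays k (fun z => f z + g z).
Proof.
move=> [cf f0] [cg g0]; split; first exact: circle_contD.
move=> j jk; under eq_fun do rewrite mulrDr.
rewrite circle_integralD ?f0 ?g0 ?addr0//;
  by apply: circle_contM => //; exact: circle_contVX.
Qed.

Lemma decaysZ k c f : decays k f -> decays k (fun z => c * f z).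
Proof.
move=> [cf f0]; split; first by apply: circle_contM => //; exact: circle_cont_cst.
move=> j jk; under eq_fun do rewrite mulrCA.
by rewrite circle_integralZ ?f0 ?mulr0//; apply: circle_contM => //; exact: circle_contVX.
Qed.

Lemma eq_decays k f g : (forall z, normc z = 1 -> f z = g z) -> decays k g -> decays k f.
Proof.
move=> fg [cg g0]; split; first exact: circle_cont_eq cg.
by move=> j jk; rewrite -(g0 j)//; apply: eq_circle_integral => z /fg ->.
Qed.

Lemma decays2_eq0 f : decays 2 f -> J f = 0.
Proof.
by move=> [_ /(_ 0)]; under eq_fun do rewrite expr0 mul1r; apply.
Qed.

(** On the circle [f z = c / z + g z / z], where the second term is O(z^-2); only [c / z]
    contributes. *)
Lemma residue_at_infinity f g c : decays 1 g ->
  (forall z, normc z = 1 -> z * f z = c + g z) -> J f = c * ((2 * pi)%:C * 'i).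
Proof.
move=> [cg g0] fg.
have -> : J f = J (fun z => c * z^-1 + z^-1 ^+ 1 * g z).
  apply: eq_circle_integral => z z1; have z0 := unit_neq0 z1.
  by rewrite [c * _]mulrC expr1 -mulrDr -fg// mulrA mulVf// mul1r.
rewrite circle_integralD; last 2 first.
- by apply: circle_contM; [exact: circle_cont_cst|exact: circle_cont_inv].
- by apply: circle_contM => //; exact: circle_contVX.
rewrite g0// addr0 circle_integralZ ?circle_integral_V//; exact: circle_cont_inv.
Qed.

Lemma holo_moments1 : holo_moments (fun=> 1).
Proof.
split; first exact: circle_cont_cst.
by move=> j; under eq_fun do rewrite mulr1; exact: circle_integral_X.
Qed.

Lemma holo_momentsD f g : holo_moments f -> holo_moments g ->
  holo_moments (fun z => f z + g z).
Proof.
move=> [cf f0] [cg g0]; split; first exact: circle_contD.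
move=> j; under eq_fun do rewrite mulrDr.
rewrite circle_integralD ?f0 ?g0 ?addr0//;
  by apply: circle_contM => //; exact: circle_contXn.
Qed.

Lemma holo_momentsZ c f : holo_moments f -> holo_moments (fun z => c * f z).
Proof.
move=> [cf f0]; split; first by apply: circle_contM => //; exact: circle_cont_cst.
move=> j; under eq_fun do rewrite mulrCA.
by rewrite circle_integralZ ?f0 ?mulr0//; apply: circle_contM => //; exact: circle_contXn.
Qed.

Lemma holo_moments_mulX f : holo_moments f -> holo_moments (fun z => z * f z).
Proof.
move=> [cf f0]; split; first by apply: circle_contM => //; exact: circle_cont_id.
by move=> j; under eq_fun do rewrite mulrA -exprSr.
Qed.

Lemma eq_holo_moments f g : (forall z, normc z = 1 -> f z = g z) ->
  holo_moments g -> holo_moments f.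
Proof.
move=> fg [cg g0]; split; first exact: circle_cont_eq cg.
by move=> j; rewrite -(g0 j)//; apply: eq_circle_integral => z /fg ->.
Qed.

Lemma holo_moments_eq0 f : holo_moments f -> J f = 0.
Proof. by move=> [_ /(_ 0%N)]; under eq_fun do rewrite expr0 mul1r. Qed.

(** Mirror image of [decays_div]: the moments of [f z / (z - p)] satisfy [b_j = p^-1 * b_(j+1)] and
    are bounded, while now |p^-1| < 1. *)
Lemma holo_moments_div f p : 1 < normc p -> holo_moments f ->
  holo_moments (fun z => f z / (z - p)).
Proof.
move=> p1 [cf Jf]; have cF := circle_cont_divB cf (negbT (gt_eqF p1)).
have p0 : p != 0 by rewrite -normc_gt0 (lt_trans _ p1).
split=> // j; set F := fun z => _.
have step n : J (fun z => z ^+ (j + n) * (f z / (z - p))) =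
    p^-1 * J (fun z => z ^+ (j + n.+1) * (f z / (z - p))).
  rewrite -circle_integralZ; last by apply: circle_contM => //; exact: circle_contXn.
  rewrite -[LHS]addr0 -(mulr0 p^-1) -(Jf (j + n)%N).
  rewrite -circle_integralZ; last by apply: circle_contM => //; exact: circle_contXn.
  rewrite -circle_integralD; last 2 first.
  - by apply: circle_contM => //; exact: circle_contXn.
  - apply: circle_contM; first exact: circle_cont_cst.
    by apply: circle_contM => //; exact: circle_contXn.
  apply: eq_circle_integral => z z1.
  by have zp := outer_neq p1 z1; rewrite addnS exprSr; field; rewrite zp p0.
have iter n : J F = p^-1 ^+ n * J (fun z => z ^+ (j + n) * (f z / (z - p))).
  elim: n => [|n ->]; first by rewrite expr0 mul1r addn0.
  by rewrite step exprSr mulrA.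
have [B hB] := circle_cont_bounded cF.
apply: eq0_normc; apply: (@geometric_eq0 _ (normc p^-1) B); rewrite ?normc_ge0//.
  by rewrite normcV invf_lt1// (lt_trans _ p1).
move=> n; rewrite (iter n) normcM normcX ler_wpM2l ?exprn_ge0 ?normc_ge0//.
apply: hB; first exact: circle_contXn.
by move=> z z1; rewrite normcX z1 expr1n.
Qed.

End moments.

(** * Rational functions and partial fractions *)

Section rfun.
Set Implicit Arguments.
Unset Strict Implicit.
Context {R : realType}.
Local Notation C := R[i]^o.
Local Notation J := (@circle_integral R).
Implicit Types (f g h : C -> C) (c p a w : C) (S : set C) (u : bool).

(* Rational functions with poles in [S]; if [u] is false, those vanishing at infinity. *)
Inductive rfun u S : (C -> C) -> Prop :=
| rfun0 : rfun u S (fun=> 0)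
| rfun_cst c : u -> rfun u S (fun=> c)
| rfun_id : u -> rfun u S (fun z => z)
| rfun_inv c p : S p -> rfun u S (fun z => c / (z - p))
| rfun_add f g : rfun u S f -> rfun u S g -> rfun u S (fun z => f z + g z)
| rfun_mul f g : rfun u S f -> rfun u S g -> rfun u S (fun z => f z * g z).

Lemma eq_rfun u S f g : f =1 g -> rfun u S g -> rfun u S f.
Proof. by move=> /funext ->. Qed.

(** For [u = false] the constant [c] is not given by a constructor, so the factor is absorbed into
    the numerators. *)
Lemma rfun_scale u S c f : rfun u S f -> rfun u S (fun z => c * f z).
Proof.
elim=> [|d hu|hu|d p Sp|{}f g _ hf _ hg|{}f g _ hf rg _].
- by apply: (@eq_rfun _ _ _ (fun=> 0)) => [z|]; [rewrite mulr0|exact: rfun0].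
- exact: rfun_cst.
- by apply: rfun_mul; [exact: rfun_cst|exact: rfun_id].
- apply: (@eq_rfun _ _ _ (fun z => (c * d) / (z - p))) => [z|]; first by rewrite mulrA.
  exact: rfun_inv.
- apply: (@eq_rfun _ _ _ (fun z => c * f z + c * g z)) => [z|]; first by rewrite mulrDr.
  exact: rfun_add.
- apply: (@eq_rfun _ _ _ (fun z => (c * f z) * g z)) => [z|]; first by rewrite mulrA.
  exact: rfun_mul.
Qed.

Lemma rfun_sub u (v : bool) S (T : set C) f : (u -> v) -> S `<=` T -> rfun u S f -> rfun v T f.
Proof.
move=> uv ST; elim=> [|d hu|hu|d p Sp|{}f g _ hf _ hg|{}f g _ hf _ hg].
- exact: rfun0.
- exact/rfun_cst/uv.
- exact/rfun_id/uv.
- exact/rfun_inv/ST.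
- exact: rfun_add.
- exact: rfun_mul.
Qed.

Lemma rfun_sum u S n (F : 'I_n -> C -> C) : (forall i, rfun u S (F i)) ->
  rfun u S (fun z => \sum_i F i z).
Proof.
elim: n F => [|n ih] F hF.
  by apply: (@eq_rfun _ _ _ (fun=> 0)) => [z|]; [rewrite big_ord0|exact: rfun0].
apply: (@eq_rfun _ _ _ (fun z => F ord0 z + \sum_i F (lift ord0 i) z)) => [z|].
  by rewrite big_ord_recl.
by apply: rfun_add => //; apply: (ih (fun i => F (lift ord0 i))).
Qed.

Lemma rfun_circle_cont u S f : (forall p, S p -> normc p != 1) -> rfun u S f ->
  circle_cont f.
Proof.
move=> S1; elim=> [|c _|_|c p Sp|{}f g _ hf _ hg|{}f g _ hf _ hg].
- exact: circle_cont_cst.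
- exact: circle_cont_cst.
- exact: circle_cont_id.
- by apply: circle_cont_divB (S1 _ Sp); exact: circle_cont_cst.
- exact: circle_contD.
- exact: circle_contM.
Qed.

(** Quantifying over [h] settles products: in [f * g * h] the factor [g] is first absorbed into [h].
    The order then rises twice, and [decaysS] forgets one of the two gains. *)
Lemma rfun_decays S f h k : (forall p, S p -> normc p < 1) -> rfun false S f ->
  decays k h -> decays k.+1 (fun z => f z * h z).
Proof.
move=> S1 rf; elim: rf k h => [//|//|//|c p Sp|{}f g _ hf _ hg|{}f g _ hf _ hg] k h dh.
- split; first by apply: circle_contM; [exact: circle_cont_cst|exact: dh.1].
  move=> j _; transitivity (J (fun z => 0 * 1)).
    by apply: eq_circle_integral => z _; rewrite !mul0r mulr0.
  by rewrite (circle_integralZ 0 (circle_cont_cst 1)) mul0r.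
- apply: (@eq_decays _ _ _ (fun z => c * (h z / (z - p)))).
    by move=> z _; rewrite mulrAC mulrA.
  by apply: decaysZ; apply: decays_div dh; exact: S1.
- apply: (@eq_decays _ _ _ (fun z => f z * h z + g z * h z)).
    by move=> z _; rewrite mulrDl.
  by apply: decaysD; [exact: hf|exact: hg].
- apply: (@eq_decays _ _ _ (fun z => f z * (g z * h z))).
    by move=> z _; rewrite mulrA.
  by apply: hf; apply: decaysS; exact: hg.
Qed.

Lemma rfun_decays1 S f : (forall p, S p -> normc p < 1) -> rfun false S f -> decays 1 f.
Proof.
move=> S1 rf; apply: (@eq_decays _ _ _ (fun z => f z * 1)) => [z _|]; first by rewrite mulr1.
exact: rfun_decays S1 rf decays1.
Qed.

Lemma rfun_holo u S f h : (forall p, S p -> 1 < normc p) -> rfun u S f ->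
  holo_moments h -> holo_moments (fun z => f z * h z).
Proof.
move=> S1 rf; elim: rf h => [|c _|_|c p Sp|{}f g _ hf _ hg|{}f g _ hf _ hg] h dh.
- exact: holo_momentsZ.
- exact: holo_momentsZ.
- exact: holo_moments_mulX.
- apply: (@eq_holo_moments _ _ (fun z => c * (h z / (z - p)))).
    by move=> z _; rewrite mulrAC mulrA.
  by apply: holo_momentsZ; apply: holo_moments_div dh; exact: S1.
- apply: (@eq_holo_moments _ _ (fun z => f z * h z + g z * h z)).
    by move=> z _; rewrite mulrDl.
  by apply: holo_momentsD; [exact: hf|exact: hg].
- apply: (@eq_holo_moments _ _ (fun z => f z * (g z * h z))).
    by move=> z _; rewrite mulrA.
  by apply: hf; exact: hg.
Qed.

Lemma rfun_holo1 u S f : (forall p, S p -> 1 < normc p) -> rfun u S f -> holo_moments f.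
Proof.
move=> S1 rf; apply: (@eq_holo_moments _ _ (fun z => f z * 1)) => [z _|]; first by rewrite mulr1.
exact: rfun_holo S1 rf holo_moments1.
Qed.

(** Carries integrals over other circles back to the unit circle. *)
Lemma rfun_comp_affine u S f a (r : C) : r != 0 -> rfun u S f ->
  rfun u [set p | S (a + r * p)] (fun z => f (a + r * z)).
Proof.
move=> r0; elim=> [|c hu|hu|c p Sp|{}f g _ hf _ hg|{}f g _ hf _ hg].
- exact: rfun0.
- exact: rfun_cst.
- apply: rfun_add; first exact: rfun_cst.
  by apply: rfun_mul; [exact: rfun_cst|exact: rfun_id].
- apply: (@eq_rfun _ _ _ (fun z => (c / r) / (z - (p - a) / r))) => [z|].
    rewrite -mulrA -invfM; congr (_ / _).
    by rewrite mulrBr mulrCA divff// mulr1; ring.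
  by apply: rfun_inv => /=; rewrite mulrCA divff// mulr1 addrC subrK.
- exact: rfun_add.
- exact: rfun_mul.
Qed.

(** The constant [c] is the limit of [z * f z] at infinity, that is, the sum of all residues of
    [f]. *)
Lemma rfun_mulX S f : rfun false S f ->
  exists c g, rfun false S g /\ forall z, ~ S z -> z * f z = c + g z.
Proof.
elim=> [//|//|//|c p Sp|{}f g rf [c [f1 [rf1 hf]]] rg [d [g1 [rg1 hg]]]|
  {}f g rf [c [f1 [rf1 hf]]] rg _].
- exists 0, (fun=> 0); split; first exact: rfun0.
  by move=> z _; rewrite mulr0 addr0.
- exists c, (fun z => (c * p) / (z - p)); split; first exact: rfun_inv.
  move=> z Sz; have zp : z - p != 0.
    by rewrite subr_eq0; apply/eqP => zp; rewrite zp in Sz.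
  by field.
- exists (c + d), (fun z => f1 z + g1 z); split; first exact: rfun_add.
  by move=> z Sz; rewrite mulrDr hf// hg// addrACA.
- exists 0, (fun z => c * g z + f1 z * g z); split.
    by apply: rfun_add; [exact: rfun_scale|exact: rfun_mul].
  by move=> z Sz; rewrite mulrA hf// mulrDl add0r.
Qed.

(** One induction yields the derivative and, for each [w], the difference quotient [D], again
    rational with poles in [S]. The quotient serves to divide by [z - w] in partial fractions and in
    Cauchy's formula; the decay of order 2 says that a derivative has no [1 / z] term at
    infinity. *)
Lemma rfun_taylor u S f : rfun u S f -> exists f',
  [/\ rfun u S f',
      (forall p, S p -> normc p < 1) -> u = false -> decays 2 f',
      forall w : C, ~ S w -> is_derive w (1 : C) f (f' w) &
      forall w : C, ~ S w -> exists D, [/\ rfun u S D,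
        forall z, ~ S z -> f z = f w + (z - w) * D z & D w = f' w]].
Proof.
elim=> [|c hu|hu|c p Sp|{}f g rf [f' [rf' df f'f hf]] rg [g' [rg' dg g'g hg]]|
  {}f g rf [f' [rf' df f'f hf]] rg [g' [rg' dg g'g hg]]].
- exists (fun=> 0); split; first exact: rfun0.
  - move=> S1 _; apply: (@eq_decays _ _ _ (fun z => 0 * (0 * 1))) => [z _|].
      by rewrite !mul0r.
    have r0 : rfun false S (fun=> 0) by exact: rfun0.
    by apply: (rfun_decays S1 r0); apply: (rfun_decays S1 r0); exact: decays1.
  - by move=> w _; exact: is_derive_cst.
  - move=> w _; exists (fun=> 0); split => //; first exact: rfun0.
    by move=> z _; rewrite mulr0 addr0.
- exists (fun=> 0); split => //; first exact: rfun0.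
  - by move=> _ u0; rewrite u0 in hu.
  - by move=> w _; exact: is_derive_cst.
  - move=> w _; exists (fun=> 0); split => //; first exact: rfun0.
    by move=> z _; rewrite mulr0 addr0.
- exists (fun=> 1); split => //; first exact: rfun_cst.
  - by move=> _ u0; rewrite u0 in hu.
  - by move=> w _; exact: is_derive_id.
  - move=> w _; exists (fun=> 1); split => //; first exact: rfun_cst.
    by move=> z _; rewrite mulr1 addrC subrK.
- have wp w : ~ S w -> w - p != 0.
    by move=> Sw; rewrite subr_eq0; apply/eqP => wp; rewrite wp in Sw.
  exists (fun z => (- c) / (z - p) * (1 / (z - p))); split.
  - by apply: rfun_mul; exact: rfun_inv.
  - move=> S1 u0; apply: (@rfun_decays S) => //; first exact: rfun_inv.
    by apply: (rfun_decays1 S1); exact: rfun_inv.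
  - move=> w Sw; have := wp _ Sw => wp'.
    have d1 : is_derive w (1 : C) (fun z : C => z - p) (1 - 0 : C).
      by apply: is_deriveB; exact: is_derive_cst.
    have dv : is_derive w (1 : C) (fun z : C => (z - p)^-1) (- (w - p) ^- 2 *: (1 - 0 : C)).
      apply: DeriveDef; first by apply: derivableV => //; case: d1.
      by rewrite deriveV//; case: d1 => _ ->.
    have := is_deriveZ c dv.
    move=> dz; apply: is_derive_eq; rewrite /GRing.scale /=.
    by field.
  - move=> w Sw; have := wp _ Sw => wp'.
    exists (fun z => (- c / (w - p)) / (z - p)); split; first exact: rfun_inv.
      by move=> z Sz; have := wp _ Sz => zp; field; rewrite zp.
    by field.
- exists (fun z => f' z + g' z); split; first exact: rfun_add.
  - by move=> S1 u0; apply: decaysD; [exact: df|exact: dg].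
  - by move=> w Sw; apply: is_deriveD; [exact: f'f|exact: g'g].
  - move=> w Sw; have [D [rD fD Dw]] := hf _ Sw; have [E [rE gE Ew]] := hg _ Sw.
    exists (fun z => D z + E z); split; first exact: rfun_add.
      by move=> z Sz; rewrite fD// gE// mulrDr addrACA.
    by rewrite Dw Ew.
- exists (fun z => f z * g' z + g z * f' z); split.
  - by apply: rfun_add; apply: rfun_mul.
  - move=> S1 u0; subst u.
    by apply: decaysD; apply: decaysS; apply: (rfun_decays S1) => //; [exact: dg|exact: df].
  - by move=> w Sw; apply: is_deriveM; [exact: f'f|exact: g'g].
  - move=> w Sw; have [D [rD fD Dw]] := hf _ Sw; have [E [rE gE Ew]] := hg _ Sw.
    exists (fun z => f w * E z + g z * D z); split.
    + by apply: rfun_add; [exact: rfun_scale|exact: rfun_mul].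
    + by move=> z Sz; rewrite {1}fD// mulrDl {1}gE//; ring.
    + by rewrite Dw Ew.
Qed.

End rfun.

(** * Partial fractions with the poles grouped into disjoint sets *)

Section partial_fractions.
Set Implicit Arguments.
Unset Strict Implicit.
Context {R : realType}.
Local Notation C := R[i]^o.
Implicit Types (f g h G : C -> C) (c p a w : C) (S : set C) (u : bool).

Variables (S0 : set C) (n : nat) (S : 'I_n -> set C).
Hypothesis S0S : forall i p, S0 p -> ~ S i p.
Hypothesis SS : forall i j p, S i p -> S j p -> i = j.

Definition free_of_poles (z : C) : Prop := ~ S0 z /\ forall i, ~ S i z.

Definition decomposable G : Prop := exists F0 F, [/\ rfun true S0 F0,
  forall i, rfun false (S i) (F i) &
  forall z, free_of_poles z -> G z = F0 z + \sum_i F i z].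

(** Decompositions are compared only off the poles, since at a pole the values are defaults of
    division by 0. *)
Lemma eq_decomposable G H : (forall z, free_of_poles z -> H z = G z) ->
  decomposable G -> decomposable H.
Proof.
by move=> HG [F0 [F [r0 r GF]]]; exists F0, F; split => // z zS; rewrite HG// GF.
Qed.

Lemma decomposable_outer u f : rfun u S0 f -> decomposable f.
Proof.
move=> rf; exists f, (fun _ _ => 0); split.
- exact: rfun_sub rf.
- by move=> i; exact: rfun0.
- by move=> z _; rewrite big1// addr0.
Qed.

Lemma decomposableD G H : decomposable G -> decomposable H ->
  decomposable (fun z => G z + H z).
Proof.
move=> [F0 [F [rF0 rF GF]]] [E0 [E [rE0 rE HE]]].
exists (fun z => F0 z + E0 z), (fun i z => F i z + E i z); split.
- exact: rfun_add.
- by move=> i; apply: rfun_add.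
- by move=> z zS; rewrite GF// HE// big_split/= addrACA.
Qed.

Lemma decomposableZ c G : decomposable G -> decomposable (fun z => c * G z).
Proof.
move=> [F0 [F [rF0 rF GF]]]; exists (fun z => c * F0 z), (fun i z => c * F i z); split.
- exact: rfun_scale.
- by move=> i; apply: rfun_scale.
- by move=> z zS; rewrite GF// mulrDr mulr_sumr.
Qed.

(** Multiplication by [z] destroys the vanishing at infinity of the [F i] by a constant each; these
    constants are moved to [F0], which may be polynomial at infinity. *)
Lemma decomposable_mulX G : decomposable G -> decomposable (fun z => z * G z).
Proof.
move=> [F0 [F [rF0 rF GF]]].
have [cE h] : {cE : 'I_n -> C * (C -> C) & forall i, rfun false (S i) (cE i).2 /\
    forall z, ~ S i z -> z * F i z = (cE i).1 + (cE i).2 z}.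
  apply: (@choice _ _ (fun i cE => rfun false (S i) cE.2 /\
    forall z, ~ S i z -> z * F i z = cE.1 + cE.2 z)) => i.
  by have [c [E ?]] := rfun_mulX (rF i); exists (c, E).
exists (fun z => z * F0 z + \sum_i (cE i).1), (fun i => (cE i).2); split.
- apply: rfun_add; last exact: rfun_cst.
  by apply: rfun_mul => //; exact: rfun_id.
- by move=> i; have [] := h i.
- move=> z [zS0 zS]; rewrite GF// mulrDr -addrA mulr_sumr -big_split /=.
  by congr (_ + _); apply: eq_bigr => i _; have [_ ->] := h i.
Qed.

Lemma rfun_quotient u T f a : rfun u T f -> ~ T a -> exists D, rfun u T D /\
  forall z, ~ T z -> z != a -> f z / (z - a) = f a / (z - a) + D z.
Proof.
move=> rf Ta; have [f' [_ _ _ /(_ _ Ta)[D [rD fD _]]]] := rfun_taylor rf.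
exists D; split => // z Tz za; rewrite fD// mulrDl; congr (_ + _).
by rewrite mulrAC divff ?mul1r// subr_eq0.
Qed.

(** [F0] absorbs the factor [1 / (z - a)]. Every [F i] is regular at [a], so it leaves a term
    [F i a / (z - a)] for [F0] and keeps its difference quotient. *)
Lemma decomposable_div0 G a : S0 a -> decomposable G ->
  decomposable (fun z => G z / (z - a)).
Proof.
move=> S0a [F0 [F [rF0 rF GF]]].
have [D h] : {D : 'I_n -> (C -> C) & forall i, rfun false (S i) (D i) /\
    forall z, ~ S i z -> z != a -> F i z / (z - a) = F i a / (z - a) + D i z}.
  apply: (@choice _ _ (fun i D => rfun false (S i) D /\
    forall z, ~ S i z -> z != a -> F i z / (z - a) = F i a / (z - a) + D z)) => i.
  by apply: rfun_quotient => //; exact: S0S.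
exists (fun z => F0 z * (1 / (z - a)) + (\sum_i F i a) / (z - a)), D; split.
- by apply: rfun_add; [apply: rfun_mul => //|]; exact: rfun_inv.
- by move=> i; have [] := h i.
- move=> z [zS0 zS]; rewrite GF// mulrDl div1r -addrA; congr (_ + _).
  rewrite !mulr_suml -big_split/=; apply: eq_bigr => i _.
  by have [_ ->//] := h i; apply: contra_notN zS0 => /eqP ->.
Qed.

(** As for [decomposable_div0], with component [j] in the role of [F0]: it collects the values at
    [a] of all the other components. *)
Lemma decomposable_div j G a : S j a -> decomposable G ->
  decomposable (fun z => G z / (z - a)).
Proof.
move=> Sja [F0 [F [rF0 rF GF]]].
have [D h] : {D : 'I_n -> (C -> C) & forall i, i != j -> rfun false (S i) (D i) /\
    forall z, ~ S i z -> z != a -> F i z / (z - a) = F i a / (z - a) + D i z}.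
  apply: (@choice _ _ (fun i D => i != j -> rfun false (S i) D /\
    forall z, ~ S i z -> z != a -> F i z / (z - a) = F i a / (z - a) + D z)) => i.
  have [->|ij] := eqVneq i j; first by exists (fun=> 0).
  have [||D hD] := @rfun_quotient false (S i) (F i) a; first exact: rF.
    by move=> Sia; move/eqP: ij; apply; exact: SS Sia Sja.
  by exists D.
have nS0a : ~ S0 a by move=> /(@S0S j); exact.
have [D0 [rD0 hD0]] := rfun_quotient rF0 nS0a.
exists D0, (fun i => if i == j then
  fun z => F j z * (1 / (z - a)) + (F0 a + \sum_(i | i != j) F i a) / (z - a) else D i).
split=> //.
- move=> i; case: ifPn => [/eqP ->|ij]; last by have [] := h i ij.
  by apply: rfun_add; [apply: rfun_mul => //|]; exact: rfun_inv.
- move=> z [zS0 zS]; have za : z != a by apply: contra_not_neq (zS j) => ->.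
  rewrite GF// mulrDl hD0// (bigD1 j)//= [in RHS](bigD1 j)//= eqxx.
  rewrite [X in _ = _ + (_ + X)](eq_bigr (fun i => D i z)); last first.
    by move=> i /negbTE ->.
  rewrite [in LHS]mulrDl div1r mulr_suml.
  rewrite (eq_bigr (fun i => F i a / (z - a) + D i z)); last first.
    by move=> i ij; have [_ ->] := h i ij.
  by rewrite big_split/= -mulr_suml; ring.
Qed.

(** Induction on the expression [f] with [G] arbitrary, so that a product multiplies [G] by one
    factor after the other. *)
Lemma decomposable_mul u f G : rfun u [set p | ~ free_of_poles p] f ->
  decomposable G -> decomposable (fun z => f z * G z).
Proof.
move=> rf; elim: rf G => [|c _|_|c p Sp|{}f g _ hf _ hg|{}f g _ hf _ hg] G dG.
- exact: decomposableZ.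
- exact: decomposableZ.
- exact: decomposable_mulX.
- apply: (@eq_decomposable (fun z => c * (G z / (z - p)))).
    by move=> z _; rewrite mulrAC mulrA.
  apply: decomposableZ; have [S0p|nS0p] := pselect (S0 p); first exact: decomposable_div0.
  have [[i Sip]|nS] := pselect (exists i, S i p); first exact: decomposable_div Sip _.
  by exfalso; apply: Sp; split => // i Sip; apply: nS; exists i.
- apply: (@eq_decomposable (fun z => f z * G z + g z * G z)).
    by move=> z _; rewrite mulrDl.
  by apply: decomposableD; [exact: hf|exact: hg].
- apply: (@eq_decomposable (fun z => f z * (g z * G z))).
    by move=> z _; rewrite mulrA.
  by apply: hf; exact: hg.
Qed.

Lemma decomposable_rfun u f : rfun u [set p | ~ free_of_poles p] f -> decomposable f.
Proof.
move=> rf; apply: (@eq_decomposable (fun z => f z * 1)) => [z _|]; first by rewrite mulr1.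
apply: decomposable_mul rf _.
by apply: (@decomposable_outer true); exact: rfun_cst.
Qed.

End partial_fractions.

(** * Quotients of polynomials as rational expressions *)

Section polynomials.
Set Implicit Arguments.
Unset Strict Implicit.
Context {R : realType}.
Local Notation C := R[i]^o.

Lemma rfun_poly S (p : {poly R[i]}) : rfun true S (fun z : C => p.[z]).
Proof.
elim/poly_ind: p => [|p c ih].
  by apply: (@eq_rfun _ _ _ _ (fun=> 0)) => [z|]; [rewrite horner0|exact: rfun0].
apply: (@eq_rfun _ _ _ _ (fun z => p.[z] * z + c)) => [z|]; first by rewrite !hornerE.
by apply: rfun_add; [apply: rfun_mul => //; exact: rfun_id|exact: rfun_cst].
Qed.

(** Over an algebraically closed field [q] splits into linear factors, each contributing one simple
    pole factor. *)
Lemma rfun_fraction S (p q : {poly R[i]}) : q != 0 ->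
  (forall z, root q z -> S z) -> rfun true S (fun z : C => p.[z] / q.[z]).
Proof.
move=> q0 qS; apply: rfun_mul; first exact: rfun_poly.
have [r qr] := closed_field_poly_normal q.
have rS z : z \in r -> S z.
  by move=> zr; apply: qS; rewrite qr rootZ ?lead_coef_eq0// root_prod_XsubC.
apply: (@eq_rfun _ _ _ _ (fun z => (lead_coef q)^-1 *
    (\prod_(x <- r) ('X - x%:P)).[z]^-1)) => [z|].
  by rewrite [in LHS]qr hornerZ invfM.
apply: rfun_scale; elim: r rS {qr} => [|x r ih] rS.
  apply: (@eq_rfun _ _ _ _ (fun=> 1)) => [z|]; last exact: rfun_cst.
  by rewrite big_nil hornerC invr1.
apply: (@eq_rfun _ _ _ _ (fun z => 1 / (z - x) *
    (\prod_(y <- r) ('X - y%:P)).[z]^-1)) => [z|].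
  by rewrite big_cons hornerM invfM hornerXsubC div1r.
apply: rfun_mul; first by apply: rfun_inv; apply: rS; rewrite mem_head.
by apply: ih => z zr; apply: rS; rewrite inE zr orbT.
Qed.

End polynomials.

(** * Residues for finitely many disjoint discs *)

Section cauchy.
Set Implicit Arguments.
Unset Strict Implicit.
Context {R : realType}.
Local Notation C := R[i]^o.
Local Notation J := (@circle_integral R).
Local Notation tpi := ((2 * pi)%:C * 'i : C).
Implicit Types (f g h : C -> C) (z w p : C).

Lemma normc_tpi : normc tpi = 2 * pi.
Proof.
rewrite normcM normc_real ger0_norm ?mulr_ge0 ?pi_ge0//.
by rewrite [normc 'i]/= expr0n expr1n add0r sqrtr1 mulr1.
Qed.

Lemma decays_inv w : normc w < 1 -> decays 1 (fun z => 1 / (z - w)).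
Proof. by move=> w1; exact: decays_div w1 decays1. Qed.

Lemma circle_integral_inv w : normc w < 1 -> J (fun z => 1 / (z - w)) = tpi.
Proof.
move=> w1; rewrite (@residue_at_infinity _ _ (fun z => w * (1 / (z - w))) 1) ?mul1r//.
  exact/decaysZ/decays_inv.
by move=> z z1; have := inner_neq w1 z1 => zw; field.
Qed.

Variables (S0 S1 : set C).
Hypothesis S0out : forall p, S0 p -> 1 < normc p.
Hypothesis S1in : forall p, S1 p -> normc p < 1.

Lemma S0_unit z : normc z = 1 -> ~ S0 z.
Proof. by move=> z1 /S0out; rewrite z1 ltxx. Qed.

(** Dividing the expansion of [f0] at [w] to second order, with remainder [(z - w) ^ 2 * E z], by
    [(z - w) ^ 2] leaves only the term [f0' w / (z - w)]: [E] is holomorphic on the disc, and the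
    other terms are O(z^-2) at infinity, including the one from [f1]. *)
Lemma cauchy_derivative f0 f0' f1 w : rfun true S0 f0 -> rfun false S1 f1 ->
  (forall w : C, ~ S0 w -> exists D, [/\ rfun true S0 D,
    forall z, ~ S0 z -> f0 z = f0 w + (z - w) * D z & D w = f0' w]) ->
  normc w < 1 ->
  J (fun z => (f0 z + f1 z) * (1 / (z - w) / (z - w))) = tpi * f0' w.
Proof.
move=> r0 r1 hf0 w1.
have S0w : ~ S0 w by move=> /S0out; rewrite ltNge (ltW w1).
have [D [rD f0D Dw]] := hf0 _ S0w.
have [_ [_ _ _ /(_ _ S0w)[E [rE DE _]]]] := rfun_taylor rD.
have d1 := decays_inv w1.
have d2 := decays_div w1 d1.
have hE := rfun_holo1 S0out rE.
have cD : circle_cont (fun z => f1 z * (1 / (z - w) / (z - w))).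
  by have [] := rfun_decays S1in r1 d2.
rewrite (@eq_circle_integral _ _ (fun z => f0 w * (1 / (z - w) / (z - w)) +
    (f0' w * (1 / (z - w)) + (E z + f1 z * (1 / (z - w) / (z - w)))))); last first.
  move=> z z1; have zw := inner_neq w1 z1; have nS0z := S0_unit z1.
  by rewrite f0D// DE// Dw; field.
have c2 : circle_cont (fun z => f0 w * (1 / (z - w) / (z - w))) by exact: (decaysZ _ d2).1.
have c1 : circle_cont (fun z => f0' w * (1 / (z - w))) by exact: (decaysZ _ d1).1.
rewrite (circle_integralD c2 (circle_contD c1 (circle_contD hE.1 cD))).
rewrite (circle_integralD c1 (circle_contD hE.1 cD)) (circle_integralD hE.1 cD).
rewrite (circle_integralZ _ d2.1) (circle_integralZ _ d1.1).
rewrite (decays2_eq0 d2) (circle_integral_inv w1) (holo_moments_eq0 hE).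
rewrite (@decays2_eq0 _ (fun z => _ * _)); first by ring.
by apply: decaysS; exact: rfun_decays S1in r1 d2.
Qed.

End cauchy.

(** * The residue theorem and the bilinear bound for disjoint discs *)

Section discs.
Set Implicit Arguments.
Unset Strict Implicit.
Context {R : realType}.
Local Notation C := R[i]^o.
Local Notation J := (@circle_integral R).
Local Notation tpi := ((2 * pi)%:C * 'i : C).
Implicit Types (f g h : C -> C) (z w p : C).

Variables (n : nat) (a : 'I_n -> C) (r : 'I_n -> R) (S0 : set C).
Hypothesis r_gt0 : forall i, 0 < r i.
Hypothesis r_small : forall i, r i <= (1 - normc (a i)) / 2.
Hypothesis disjoint_discs : forall i j, i != j -> r i + r j < normc (a i - a j).
Hypothesis S0out : forall p, S0 p -> 1 < normc p.

Local Notation S := (fun i => open_disc (a i) (r i)).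
Local Notation free := (free_of_poles S0 S).
Hypothesis free_near_circle : forall z, normc z = 1 -> \forall w \near z, free w.

Let U : set C := [set p | exists i, S i p].

Lemma disc_in i p : normc (p - a i) <= r i -> normc p < 1.
Proof.
move=> pi_; have := r_gt0 i; have := r_small i; have := normc_tri p (a i) 0.
by rewrite !subr0; lra.
Qed.

Let S0S i p : S0 p -> ~ S i p.
Proof.
move=> /S0out p1 Sip; have := @disc_in i p (ltW Sip).
by rewrite ltNge (ltW p1).
Qed.

Lemma disjoint_disc i j p : normc (p - a i) <= r i -> normc (p - a j) <= r j -> i = j.
Proof.
move=> pi_ pj; apply/eqP; apply: contraPT isT => ij _.
have := disjoint_discs ij; have := normc_tri (a i) p (a j).
by rewrite (normc_distC (a i) p); lra.
Qed.

Let SS i j p : S i p -> S j p -> i = j.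
Proof. by move=> /ltW ? /ltW; exact: disjoint_disc. Qed.

Let Uin p : U p -> normc p < 1.
Proof. by move=> [i /ltW]; exact: disc_in. Qed.

Lemma free_circle z : normc z = 1 -> free z.
Proof.
move=> z1; split; first by move=> /S0out; rewrite z1 ltxx.
by move=> i /ltW /disc_in; rewrite z1 ltxx.
Qed.

(** The strict inequality in [disjoint_discs] makes the closed discs disjoint, so a boundary circle
    meets no other disc; it misses its own because that disc is open. *)
Lemma free_boundary i z : normc z = 1 -> free (a i + (r i)%:C * z).
Proof.
move=> z1; have e : normc (a i + (r i)%:C * z - a i) = r i.
  by rewrite addrC addKr normcM z1 mulr1 normc_real gtr0_norm.
split.
  by move=> /S0out; apply/negP; rewrite -leNgt ltW// (@disc_in i)// e.
move=> j Sj; have ij : i = j.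
  by apply: (@disjoint_disc _ _ (a i + (r i)%:C * z)); [rewrite e|exact: ltW].
by move: Sj; rewrite -ij /open_disc /= e ltxx.
Qed.

Let rC i : (r i)%:C != 0 :> C.
Proof. by rewrite (inj_eq (@complexI _)) gt_eqF. Qed.

Lemma circle_cont_sum m (F : 'I_m -> C -> C) : (forall i, circle_cont (F i)) ->
  circle_cont (fun z => \sum_i F i z).
Proof.
elim: m F => [|m ih] F cF.
  by apply: circle_cont_eq (circle_cont_cst 0) => z _; rewrite big_ord0.
apply: (@circle_cont_eq _ _ (fun z => F ord0 z + \sum_i F (lift ord0 i) z)) => [z _|].
  by rewrite big_ord_recl.
by apply: circle_contD => //; exact: ih.
Qed.

Lemma circle_integral_sum m (F : 'I_m -> C -> C) : (forall i, circle_cont (F i)) ->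
  J (fun z => \sum_i F i z) = \sum_i J (F i).
Proof.
elim: m F => [|m ih] F cF.
  rewrite big_ord0 (@eq_circle_integral _ _ (fun z => 0 * 1)) => [|z _]; last first.
    by rewrite big_ord0 mul0r.
  by rewrite (circle_integralZ 0 (circle_cont_cst 1)) mul0r.
have cs : circle_cont (fun z => \sum_i F (lift ord0 i) z) by exact: circle_cont_sum.
rewrite big_ord_recl -ih// -circle_integralD//.
by apply: eq_circle_integral => z _; rewrite big_ord_recl.
Qed.

(** Each inner part has the same integral over the unit circle as over the boundary of its own disc,
    where every other part is holomorphic inside and integrates to 0. Boundary circles are rescaled
    to the unit circle, whence the factors [r i]. *)
Lemma residue_theorem h : decomposable S0 S h ->
  J h = \sum_i (r i)%:C * J (fun z => h (a i + (r i)%:C * z)).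
Proof.
move=> [H0 [H [rH0 rH hE]]].
have dH i : decays 1 (H i).
  by apply: rfun_decays1 (rH i) => p /ltW; exact: disc_in.
have hH0 := rfun_holo1 S0out rH0.
have -> : J h = \sum_i J (H i).
  rewrite -circle_integral_sum; last by move=> i; exact: (dH i).1.
  have rs : rfun false U (fun z => \sum_i H i z).
    by apply: rfun_sum => i; apply: rfun_sub (rH i) => // p; exists i.
  transitivity (J H0 + J (fun z => \sum_i H i z)); last first.
    by rewrite (holo_moments_eq0 hH0) add0r.
  rewrite -circle_integralD; [|exact: hH0.1|exact: (rfun_decays1 Uin rs).1].
  by apply: eq_circle_integral => z z1; rewrite hE//; exact: free_circle.
apply: eq_bigr => i _.
have hH0i : holo_moments (fun z => H0 (a i + (r i)%:C * z)).
  apply: rfun_holo1 (rfun_comp_affine (a i) (rC i) rH0) => p /= /S0out.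
  rewrite ltNge => /negP h1; rewrite ltNge; apply/negP => p1; apply: h1.
  apply/ltW/(@disc_in i); rewrite addrC addKr normcM normc_real gtr0_norm//.
  by rewrite ler_piMr// ltW.
have hHij j : i != j -> holo_moments (fun z => H j (a i + (r i)%:C * z)).
  move=> ij; apply: rfun_holo1 (rfun_comp_affine (a i) (rC i) (rH j)) => p /= Sp.
  rewrite ltNge; apply/negP => p1; move/eqP: ij; apply.
  apply: (@disjoint_disc _ _ (a i + (r i)%:C * p)); last exact: ltW.
  rewrite addrC addKr normcM normc_real gtr0_norm//.
  by rewrite ler_piMr// ltW.
have Pin (p : C) : open_disc (a i) (r i) (a i + (r i)%:C * p) -> normc p < 1.
  rewrite /open_disc /= addrC addKr normcM normc_real gtr0_norm//.
  by rewrite -[X in _ < X]mulr1 ltr_pM2l.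
have dHi := rfun_decays1 Pin (rfun_comp_affine (a i) (rC i) (rH i)).
have -> : J (fun z => h (a i + (r i)%:C * z)) = J (fun z => H i (a i + (r i)%:C * z)).
  have chj j : circle_cont (fun z => H j (a i + (r i)%:C * z)).
    by have [<-|ij] := eqVneq i j; [exact: dHi.1|exact: (hHij j ij).1].
  transitivity (J (fun z => H0 (a i + (r i)%:C * z) + \sum_j H j (a i + (r i)%:C * z))).
    by apply: eq_circle_integral => z z1; rewrite hE//; exact: free_boundary.
  have cs := circle_cont_sum chj.
  rewrite circle_integralD// ?(holo_moments_eq0 hH0i) ?add0r; last exact: hH0i.1.
  rewrite (circle_integral_sum chj) (bigD1 i)//= big1 ?addr0// => j.
  by rewrite eq_sym => ij; exact: holo_moments_eq0 (hHij j ij).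
rewrite -circle_integralZ; last exact: dHi.1.
(* Both integrals equal 2 pi i times [c], the limit of [z * H i z] at infinity, which the affine
   change of variable together with the factor [r i] preserves. *)
have [c [G [rG zH]]] := rfun_mulX (rH i).
have dG : decays 1 G by apply: rfun_decays1 rG => p /ltW; exact: disc_in.
rewrite (residue_at_infinity dG (c := c)); last first.
  by move=> z z1; rewrite zH//; have [_] := free_circle z1; exact.
rewrite (@residue_at_infinity _ _ (fun z => G (a i + (r i)%:C * z) +
   (- a i) * H i (a i + (r i)%:C * z)) c)//.
  apply: decaysD; last exact: decaysZ.
  exact: rfun_decays1 Pin (rfun_comp_affine (a i) (rC i) rG).
move=> z z1; rewrite addrA -zH; last by have [_] := free_boundary i z1; exact.
by ring.
Qed.

Let rfun_decomposable u f : rfun u [set p | ~ free p] f -> decomposable S0 S f.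
Proof. by apply: decomposable_rfun => [i p|i j p]; [exact: S0S|exact: SS]. Qed.

Lemma rfun_split f : rfun true [set p | ~ free p] f ->
  exists f0 f1, [/\ rfun true S0 f0, rfun false U f1 &
    forall z, free z -> f z = f0 z + f1 z].
Proof.
move=> /rfun_decomposable[F0 [F [rF0 rF fE]]]; exists F0, (fun z => \sum_i F i z).
by split => //; apply: rfun_sum => i; apply: rfun_sub (rF i) => // p; exists i.
Qed.

Lemma free_U z : free z -> ~ U z.
Proof. by move=> [_ h] [j]; exact: h. Qed.

(** A derivative depends on points off the circle, so the splitting has to hold in a neighbourhood;
    this is the purpose of [free_near_circle]. *)
Lemma cderiv_circle f f0 f1 f0' f1' z :
  (forall z, free z -> f z = f0 z + f1 z) ->
  (forall w : C, ~ S0 w -> is_derive w (1 : C) f0 (f0' w)) ->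
  (forall w : C, ~ U w -> is_derive w (1 : C) f1 (f1' w)) ->
  normc z = 1 -> cderiv f z = f0' z + f1' z.
Proof.
move=> fE df0 df1 z1; have [fz fU] := (free_circle z1, free_U (free_circle z1)).
rewrite /cderiv derive1E.
rewrite (@near_eq_derive _ _ _ f (fun z => f0 z + f1 z)); last first.
  by apply: filterS (free_near_circle z1) => w /fE.
by have := is_deriveD (df0 _ fz.1) (df1 _ fU) => dd; rewrite derive_val.
Qed.

(** The derivative of the outer part is holomorphic on the disc, and that of the inner part is
    O(z^-2) at infinity. *)
Lemma integral_of_derivative h : rfun true [set p | ~ free p] h ->
  J (cderiv h) = 0.
Proof.
move=> /rfun_split[h0 [h1 [r0 r1 hE]]].
have [h0' [r0' _ d0 _]] := rfun_taylor r0.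
have [h1' [r1' /(_ Uin erefl) dec1 d1 _]] := rfun_taylor r1.
have hol := rfun_holo1 S0out r0'.
rewrite (@eq_circle_integral _ _ (fun z => h0' z + h1' z)); last first.
  by move=> z; exact: cderiv_circle.
by rewrite (circle_integralD hol.1 dec1.1) (holo_moments_eq0 hol) (decays2_eq0 dec1) addr0.
Qed.

Lemma cderiv_mul f g z (v w : C) :
  is_derive z (1 : C) f v -> is_derive z (1 : C) g w ->
  cderiv (fun z => f z * g z) z = v * g z + f z * w.
Proof.
move=> df dg; have := is_deriveM df dg => dfg.
rewrite /cderiv derive1E derive_val /GRing.scale /=; ring.
Qed.

Variables (f g : C -> C) (A B : R).
Hypothesis rf : rfun true [set p | ~ free p] f.
Hypothesis rg : rfun true [set p | ~ free p] g.
Hypothesis fA : forall z, normc z <= 1 -> free z -> normc (f z) <= A.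
Hypothesis gB : forall z, normc z <= 1 -> free z -> normc (g z) <= B.

(* With [f = f0 + f1] split into the parts with outer and inner poles, [f1' * g1]
   and [f0 * g0'] integrate to 0, and [f1' * g0] is integrated by parts. *)
Lemma bilinear_residue : exists f0' g0',
  [/\ rfun true S0 f0', rfun true S0 g0',
      J (fun z => cderiv f z * g z) =
        J (fun z => f0' z * g z) - J (fun z => f z * g0' z),
      forall w, normc w < 1 -> normc (f0' w) <= A / (1 - normc w) ^+ 2 &
      forall w, normc w < 1 -> normc (g0' w) <= B / (1 - normc w) ^+ 2].
Proof.
have [f0 [f1 [rf0 rf1 fE]]] := rfun_split rf.
have [g0 [g1 [rg0 rg1 gE]]] := rfun_split rg.
have [f0' [rf0' _ df0 tf0]] := rfun_taylor rf0.
have [g0' [rg0' _ dg0 tg0]] := rfun_taylor rg0.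
have [f1' [rf1' /(_ Uin erefl) decf1' df1 _]] := rfun_taylor rf1.
have hf0 := rfun_holo1 S0out rf0; have hg0 := rfun_holo1 S0out rg0.
have hf0' := rfun_holo1 S0out rf0'; have hg0' := rfun_holo1 S0out rg0'.
have decf1 := rfun_decays1 Uin rf1; have decg1 := rfun_decays1 Uin rg1.
have cf : circle_cont f.
  apply: circle_cont_eq (circle_contD hf0.1 decf1.1) => z /free_circle; exact: fE.
have cg : circle_cont g.
  apply: circle_cont_eq (circle_contD hg0.1 decg1.1) => z /free_circle; exact: gE.
(* Cauchy's formula on the unit circle with |z - w| >= 1 - |w|; the inner part of [F] drops out, so
   the bound on all of [F] controls the derivative of [F0] alone. *)
have bound (F F0 F1 F0' : C -> C) (K : R) w : rfun true S0 F0 -> rfun false U F1 ->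
    (forall w : C, ~ S0 w -> exists D, [/\ rfun true S0 D,
      forall z, ~ S0 z -> F0 z = F0 w + (z - w) * D z & D w = F0' w]) ->
    (forall z, free z -> F z = F0 z + F1 z) ->
    (forall z, normc z <= 1 -> free z -> normc (F z) <= K) ->
    normc w < 1 -> normc (F0' w) <= K / (1 - normc w) ^+ 2.
  move=> rF0 rF1 tF FE FK w1.
  have pi2 : 0 < 2 * pi :> R by rewrite mulr_gt0// pi_gt0.
  rewrite -(ler_pM2l pi2) -{1}normc_tpi -normcM.
  rewrite -(cauchy_derivative S0out Uin rF0 rF1 tF w1).
  have d2 := decays_div w1 (decays_inv w1).
  apply: normc_circle_integral.
    apply: circle_contM d2.1; apply: circle_contD; first exact: (rfun_holo1 S0out rF0).1.
    exact: (rfun_decays1 Uin rF1).1.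
  move=> z z1; have fz := free_circle z1; rewrite -FE// mul1r -invfM -expr2 normcM normcV normcX.
  have w10 : 0 < 1 - normc w by rewrite subr_gt0.
  have zw : 1 - normc w <= normc (z - w).
    by rewrite lerBlDr -z1 -{1}(subrK w z) normcD.
  have zw0 : 0 < normc (z - w) by exact: lt_le_trans zw.
  apply: ler_pM; rewrite ?normc_ge0 ?invr_ge0 ?exprn_ge0 ?normc_ge0 ?FK ?z1//.
  by rewrite lef_pV2 ?posrE ?exprn_gt0// lerXn2r// nnegrE ltW.
exists f0', g0'; split => //; last 2 first.
- by move=> w; exact: bound tf0 fE fA.
- by move=> w; exact: bound tg0 gE gB.
have cf1'g0 : circle_cont (fun z => f1' z * g0 z) by apply: circle_contM; [exact: decf1'.1|exact: hg0.1].
have cf0'g : circle_cont (fun z => f0' z * g z) by apply: circle_contM; [exact: hf0'.1|].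
have decfg := decaysS (rfun_decays Uin rg1 decf1').
have E1 : J (fun z => cderiv f z * g z) = J (fun z => f0' z * g z) + J (fun z => f1' z * g0 z).
  rewrite -[RHS]addr0 -(decays2_eq0 decfg) -(circle_integralD cf0'g cf1'g0).
  rewrite -(circle_integralD (circle_contD cf0'g cf1'g0) decfg.1).
  apply: eq_circle_integral => z z1; rewrite (cderiv_circle fE df0 df1 z1).
  by rewrite (gE _ (free_circle z1)); ring.
have cf1g0' : circle_cont (fun z => f1 z * g0' z) by apply: circle_contM; [exact: decf1.1|exact: hg0'.1].
have E2 : J (fun z => f1' z * g0 z) + J (fun z => f1 z * g0' z) = 0.
  rewrite -(circle_integralD cf1'g0 cf1g0').
  have rfg : rfun true [set p | ~ free p] (fun z => f1 z * g0 z).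
    apply: rfun_mul; last by apply: rfun_sub rg0 => // p S0p [].
    by apply: rfun_sub rf1 => // p Up /free_U; exact.
  rewrite -(integral_of_derivative rfg); apply: eq_circle_integral => z z1.
  have fz := free_circle z1.
  by rewrite (cderiv_mul (df1 _ (free_U fz)) (dg0 _ fz.1)).
have hfg := rfun_holo S0out rf0 hg0'.
have E3 : J (fun z => f z * g0' z) = J (fun z => f1 z * g0' z).
  rewrite -[RHS]add0r -(holo_moments_eq0 hfg) -(circle_integralD hfg.1 cf1g0').
  by apply: eq_circle_integral => z z1; rewrite (fE _ (free_circle z1)) mulrDl.
by rewrite E1 E3; congr (_ + _); apply/eqP; rewrite -addr_eq0 E2.
Qed.

(** On the boundary of disc [i], [r_small] gives 1 - |w| >= (1 - |a_i|) / 2, which costs a factor 4.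
    With the length 2 pi r_i and the two integrals of [bilinear_residue] this makes 16 pi. *)
Lemma circle_integral_bound :
  normc (J (fun z => cderiv f z * g z)) <=
    16 * pi * A * B * \sum_i r i / (1 - normc (a i)) ^+ 2.
Proof.
have [f0' [g0' [rf0' rg0' -> bf bg]]] := bilinear_residue.
have r0 u h : rfun u S0 h -> rfun u [set p | ~ free p] h.
  by apply: rfun_sub => // p S0p [].
have rfg : rfun true [set p | ~ free p] (fun z => f0' z * g z) by apply: rfun_mul => //; exact: r0.
have rgf : rfun true [set p | ~ free p] (fun z => f z * g0' z) by apply: rfun_mul => //; exact: r0.
have circ i h : rfun true [set p | ~ free p] h -> circle_cont (fun z => h (a i + (r i)%:C * z)).
  move=> /(rfun_comp_affine (a i) (rC i)); apply: rfun_circle_cont => p /= nfree.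
  by apply: contra_notN nfree => /eqP; exact: free_boundary.
have pi2 : 0 <= 2 * pi :> R by rewrite mulr_ge0// pi_ge0.
have est h (K : R) : rfun true [set p | ~ free p] h ->
    (forall w, normc w < 1 -> free w -> normc (h w) <= K / (1 - normc w) ^+ 2) ->
    normc (J h) <= 8 * pi * K * \sum_i r i / (1 - normc (a i)) ^+ 2.
  move=> rh hK; rewrite (residue_theorem (rfun_decomposable rh)).
  apply: (@le_trans _ _ (\sum_i r i * (2 * pi * (4 * K / (1 - normc (a i)) ^+ 2)))).
    elim/big_ind2: _ => [|x1 x2 y1 y2 h1 h2|i _]; first by rewrite normc0.
      by apply: le_trans (normcD _ _) _; exact: lerD.
    rewrite normcM normc_real gtr0_norm// ler_pM2l//.
    apply: normc_circle_integral; first exact: circ.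
    move=> z z1; set w := _ + _.
    have wa : normc (w - a i) = r i.
      by rewrite addrC addKr normcM z1 mulr1 normc_real gtr0_norm.
    have w1 : normc w < 1 by apply: (@disc_in i); rewrite wa.
    have fw : free w by exact: free_boundary.
    apply: le_trans (hK _ w1 fw) _.
    have K0 : 0 <= K.
      have := le_trans (normc_ge0 _) (hK _ w1 fw).
      by rewrite pmulr_lge0// invr_gt0 exprn_gt0// subr_gt0.
    have wai : normc w <= normc (a i) + r i.
      by rewrite -wa -{1}(subrK (a i) w) addrC normcD.
    have ri := r_gt0 i; have rs := r_small i.
    have s0 : 0 < 1 - normc (a i) by lra.
    have -> : 4 * K / (1 - normc (a i)) ^+ 2 = K / ((1 - normc (a i)) / 2) ^+ 2.
      by field; rewrite gt_eqF.
    rewrite ler_wpM2l// lef_pV2 ?posrE ?exprn_gt0// ?subr_gt0//; last by lra.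
    by apply: lerXn2r; rewrite ?nnegrE; lra.
  by rewrite mulr_sumr ler_sum// => i _; rewrite le_eqVlt; apply/orP; left; apply/eqP; ring.
have i0 := normcB (J (fun z => f0' z * g z)) (J (fun z => f z * g0' z)).
have A0 : 0 <= A.
  by have f1 := @free_circle 1 (normc1 _); apply: le_trans (fA _ f1); rewrite ?normc_ge0 ?normc1.
have B0 : 0 <= B.
  by have f1 := @free_circle 1 (normc1 _); apply: le_trans (gB _ f1); rewrite ?normc_ge0 ?normc1.
have e1 := est _ (A * B) rfg; have e2 := est _ (A * B) rgf.
apply: le_trans i0 _; apply: le_trans (lerD (e1 _) (e2 _)) _.
- move=> w w1 fw; rewrite normcM mulrAC ler_pM ?normc_ge0 ?bf//.
  by rewrite gB// ltW.
- move=> w w1 fw; rewrite normcM -mulrA ler_pM ?normc_ge0 ?bg//.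
  by rewrite fA// ltW.
- by rewrite le_eqVlt; apply/orP; left; apply/eqP; ring.
Qed.

End discs.

(** * Overlapping and infinitely many discs *)

Section topology.
Set Implicit Arguments.
Unset Strict Implicit.
Context {R : realType}.
Local Notation C := R[i]^o.
Implicit Types (z w : C).

(** Balls of [R[i]] have complex radii; positivity forces the imaginary part of a radius to vanish,
    which gives real radii. *)
Lemma near_normc z (P : set C) : (\forall w \near z, P w) <->
  exists2 e : R, 0 < e & forall w, normc (w - z) < e -> P w.
Proof.
split.
  move=> /nbhs_ballP[[e1 e2] /= e0 eP].
  have [/eqP e20 e10] : e2 == 0 /\ 0 < e1 by move: e0; rewrite ltcE /= => /andP[].
  exists e1 => // w we; apply: eP; rewrite /ball /= normc_norm normc_distC e20.
  by rewrite ltcR.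
move=> [e e0 eP]; apply/nbhs_ballP; exists (e%:C) => /=; first by rewrite ltcR.
move=> w; rewrite /ball /= normc_norm ltcR normc_distC; exact: eP.
Qed.

Lemma continuous_rfun u (S : set C) (f : C -> C) z : rfun u S f -> ~ S z ->
  {for z, continuous f}.
Proof.
move=> rf Sz; have [f' [_ _ df _]] := rfun_taylor rf.
by have [dz _] := df _ Sz; apply/differentiable_continuous/derivable1_diffP.
Qed.

Lemma continuous_poly (p : {poly R[i]}) : continuous (fun z : C => p.[z] : C).
Proof.
by move=> z; exact: (continuous_rfun (rfun_poly set0 p)).
Qed.

Lemma cvg_normc (f : C -> C) z (e : R) : {for z, continuous f} -> 0 < e ->
  \forall w \near z, normc (f w - f z) < e.
Proof.
move=> cf e0.
have : \forall v \near f z, normc (v - f z) < e by apply/near_normc; exists e.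
exact: cf.
Qed.

Lemma near_root (p : {poly R[i]}) z : ~~ root p z -> \forall w \near z, ~~ root p w.
Proof.
move=> pz; have p0 : 0 < normc p.[z] by rewrite normc_gt0.
apply: filterS (cvg_normc (@continuous_poly p z) p0) => w.
by apply: contraTN => /eqP ->; rewrite sub0r normcN ltxx.
Qed.

End topology.

(** * Merging overlapping discs without increasing the total weight *)

Section merging.
Set Implicit Arguments.
Unset Strict Implicit.
Context {R : realType}.
Local Notation C := R[i]^o.
Implicit Types (d e : C * R) (L : seq (C * R)).

(** The contribution of one disc to the sum in [circle_integral_bound]. *)
Definition weight d : R := d.2 / (1 - normc d.1) ^+ 2.

Definition disc_seq L : Prop := forall d, d \in L -> 0 < d.2 /\ normc d.1 < 1.

Definition apart d e : bool := d.2 + e.2 < normc (d.1 - e.1).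

Definition covers L : set C := [set z | exists2 d, d \in L & open_disc d.1 d.2 z].

(* The centre is the barycentre weighted by the radii, so that Jensen's
   inequality for the convex function [1 / x ^ 2] makes [weight] subadditive. *)
Definition merge d e : C * R :=
  ((d.2 / (d.2 + e.2))%:C * d.1 + (e.2 / (d.2 + e.2))%:C * e.1, d.2 + e.2).

Lemma weight_ge0 d : 0 < d.2 -> 0 <= weight d.
Proof. by move=> d0; rewrite divr_ge0 ?sqr_ge0 ?ltW. Qed.

Lemma weight_merge d e : 0 < d.2 -> 0 < e.2 -> normc d.1 < 1 -> normc e.1 < 1 ->
  normc (merge d e).1 < 1 /\ weight (merge d e) <= weight d + weight e.
Proof.
case: d e => [a r] [b s]; rewrite /weight /merge /= => r0 s0 a1 b1.
set c := _ + _.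
have rs : 0 < r + s by rewrite addr_gt0.
have rsn : r + s != 0 by rewrite gt_eqF.
(* The mean distance of the two centres to the unit circle; the new centre is at least as far from
   it, by convexity of the modulus. *)
set m := (r * (1 - normc a) + s * (1 - normc b)) / (r + s).
have m0 : 0 < m.
  by rewrite divr_gt0// addr_gt0// mulr_gt0// subr_gt0.
have cm : normc c <= 1 - m.
  have r1 : 0 <= r / (r + s) by rewrite divr_ge0 ?ltW.
  have s1 : 0 <= s / (r + s) by rewrite divr_ge0 ?ltW.
  apply: le_trans (normcD _ _) _; rewrite !normcM !normc_real (ger0_norm r1) (ger0_norm s1).
  by rewrite le_eqVlt; apply/orP; left; apply/eqP; rewrite /m; field.
split; first by rewrite (le_lt_trans cm)// gtrBl.
(* The tangent line at [m] of the convex function [x ^ -2] lies below its graph. Averaging it at the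
   two distances gives exactly [m ^ -2]. *)
have tangent (x : R) : 0 < x -> (3 * m - 2 * x) / m ^+ 3 <= (x ^+ 2)^-1.
  move=> x0; rewrite -[(x ^+ 2)^-1]mul1r ler_pdivrMr ?exprn_gt0// mulrAC ler_pdivlMr ?exprn_gt0//.
  rewrite mul1r -subr_ge0.
  have -> : m ^+ 3 - (3 * m - 2 * x) * x ^+ 2 = (m - x) ^+ 2 * (m + 2 * x) by ring.
  by apply: mulr_ge0; [exact: sqr_ge0|clearbody m; lra].
have ta : 0 < 1 - normc a by rewrite subr_gt0.
have tb : 0 < 1 - normc b by rewrite subr_gt0.
apply: (@le_trans _ _ ((r + s) / m ^+ 2)).
  rewrite ler_pM2l// lef_pV2 ?posrE ?exprn_gt0//; last by lra.
  by apply: lerXn2r; rewrite ?nnegrE; lra.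
have -> : (r + s) / m ^+ 2 = r * ((3 * m - 2 * (1 - normc a)) / m ^+ 3) +
    s * ((3 * m - 2 * (1 - normc b)) / m ^+ 3).
  have e : r * (1 - normc a) + s * (1 - normc b) = m * (r + s) by rewrite /m divfK.
  have m0n : m != 0 by rewrite gt_eqF.
  have -> : r * ((3 * m - 2 * (1 - normc a)) / m ^+ 3) +
    s * ((3 * m - 2 * (1 - normc b)) / m ^+ 3) =
    (3 * m * (r + s) - 2 * (r * (1 - normc a) + s * (1 - normc b))) / m ^+ 3.
    by clearbody m; field.
  by rewrite e; clearbody m; field.
by rewrite lerD// ler_pM2l// tangent.
Qed.

Lemma merge_covers d e z : 0 < d.2 -> 0 < e.2 -> ~~ apart d e ->
  open_disc d.1 d.2 z \/ open_disc e.1 e.2 z ->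
  open_disc (merge d e).1 (merge d e).2 z.
Proof.
case: d e => [a r] [b s]; rewrite /apart /merge /open_disc /= -leNgt => r0 s0 ab.
have rs : 0 < r + s by rewrite addr_gt0.
have rsn : r + s != 0 by rewrite gt_eqF.
have rsc : (r + s)%:C != 0 :> C by rewrite (inj_eq (@complexI _)).
pose c : C := (r / (r + s))%:C * a + (s / (r + s))%:C * b; rewrite -/c.
have ca : normc (a - c) <= s.
  have -> : a - c = (s / (r + s))%:C * (a - b).
    have : (r / (r + s))%:C + (s / (r + s))%:C = 1 :> C.
      by rewrite -rmorphD /= -mulrDl divff.
    by move=> /eqP; rewrite addrC eq_sym -subr_eq => /eqP e; rewrite /c -e; ring.
  rewrite normcM normc_real gtr0_norm ?divr_gt0// mulrAC ler_pdivrMr//.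
  by rewrite ler_pM2l.
have cb : normc (b - c) <= r.
  have -> : b - c = (r / (r + s))%:C * (b - a).
    have : (r / (r + s))%:C + (s / (r + s))%:C = 1 :> C.
      by rewrite -rmorphD /= -mulrDl divff.
    by move=> /eqP; rewrite eq_sym -subr_eq => /eqP e; rewrite /c -e; ring.
  rewrite normcM normc_real gtr0_norm ?divr_gt0// mulrAC ler_pdivrMr//.
  by rewrite ler_pM2l// normc_distC.
by move=> [za|zb]; [have := normc_tri z a c|have := normc_tri z b c]; lra.
Qed.

Lemma not_pairwise (T : eqType) (r : rel T) (L : seq T) : ~~ pairwise r L ->
  exists x y M, perm_eq L [:: x, y & M] /\ ~~ r x y.
Proof.
elim: L => [//|x L ih] /=; rewrite negb_and => /orP[/allPn[y yL xy]|/ih[y [z [M [LM yz]]]]].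
  by exists x, y, (rem y L); split => //; rewrite perm_cons perm_to_rem.
exists y, z, (x :: M); split => //.
apply: (@perm_trans _ [:: x, y, z & M]); first by rewrite perm_cons.
by rewrite (perm_catCA [:: x] [:: y; z] M).
Qed.

(** A merged disc may meet further discs, but each merge lowers the number of discs by one, so the
    process ends. *)
Lemma merge_discs L (c : R) : disc_seq L -> \sum_(d <- L) weight d <= c ->
  exists M, [/\ disc_seq M, \sum_(d <- M) weight d <= c, pairwise apart M &
    covers L `<=` covers M].
Proof.
have [n] := ubnP (size L); elim: n L => // n ih L sL dL Lc.
have [pL|] := boolP (pairwise apart L); first by exists L; split => // z.
move=> /not_pairwise[d [e [M [LM de]]]].
have mem x : x \in [:: d, e & M] -> 0 < x.2 /\ normc x.1 < 1.
  by rewrite -(perm_mem LM); exact: dL.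
have [d0 d1] : 0 < d.2 /\ normc d.1 < 1 by apply: mem; rewrite mem_head.
have [e0 e1] : 0 < e.2 /\ normc e.1 < 1 by apply: mem; rewrite !inE eqxx orbT.
have [m1 mw] := weight_merge d0 e0 d1 e1.
have [||| N [dN Nc pN MN]] := ih (merge d e :: M).
- by move: sL; rewrite (perm_size LM).
- move=> x; rewrite inE => /orP[/eqP ->|xM]; first by split => //; exact: addr_gt0.
  by apply: mem; rewrite !inE xM !orbT.
- apply: le_trans Lc; rewrite (perm_big _ LM) !big_cons /= addrA.
  by rewrite lerD2r.
exists N; split => //; apply: subset_trans MN => z [x].
rewrite (perm_mem LM) !inE => /or3P[/eqP ->|/eqP ->|xM] zx.
- by exists (merge d e); rewrite ?mem_head//; apply: merge_covers => //; left.
- by exists (merge d e); rewrite ?mem_head//; apply: merge_covers => //; right.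
- by exists x => //; rewrite inE xM orbT.
Qed.

(** After merging, the discs cover more, so the assumptions on the complement of [L] persist on the
    smaller complement of [M]. *)
Lemma finite_discs_bound L (c A B : R) (p1 q1 p2 q2 : {poly R[i]}) :
  disc_seq L -> \sum_(d <- L) weight d <= c -> c <= 1 / 2 ->
  (forall z, normc z <= 1 -> ~ covers L z -> ~~ root q1 z) ->
  (forall z, normc z <= 1 -> ~ covers L z -> ~~ root q2 z) ->
  (forall z, normc z <= 1 -> ~ covers L z -> normc (p1.[z] / q1.[z]) <= A) ->
  (forall z, normc z <= 1 -> ~ covers L z -> normc (p2.[z] / q2.[z]) <= B) ->
  normc (circle_integral (fun z => cderiv (fun z => p1.[z] / q1.[z]) z * (p2.[z] / q2.[z])))
    <= 16 * pi * A * B * c.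
Proof.
move=> dL Lc c2 h1 h2 hA hB.
have [M [dM Mc pM LM]] := merge_discs dL Lc.
have wM d : d \in M -> weight d <= 1 / 2.
  move=> dMd; apply: le_trans c2; apply: le_trans Mc.
  rewrite (perm_big _ (perm_to_rem dMd)) big_cons lerDl big_seq sumr_ge0// => x /mem_rem xM.
  by apply: weight_ge0; have [] := dM _ xM.
pose a (i : 'I_(size M)) : C := (nth (0, 0) M i).1.
pose r (i : 'I_(size M)) : R := (nth (0, 0) M i).2.
have mem (i : 'I_(size M)) : nth (0, 0) M i \in M by rewrite mem_nth.
have r_gt0 i : 0 < r i by have [] := dM _ (mem i).
have a1 i : normc (a i) < 1 by have [] := dM _ (mem i).
(* Weight at most 1/2 means r <= (1 - |a|)^2 / 2, and 1 - |a| <= 1. *)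
have r_small i : r i <= (1 - normc (a i)) / 2.
  have s0 : 0 < 1 - normc (a i) by rewrite subr_gt0.
  have := wM _ (mem i); rewrite /weight -/(a i) -/(r i) ler_pdivrMr ?exprn_gt0//.
  by have := normc_ge0 (a i); nra.
have disj i j : i != j -> r i + r j < normc (a i - a j).
  move=> ij; move/(pairwiseP (0, 0)): pM => pM.
  have [ij'|ji|/val_inj ijE] := ltngtP i j; last by rewrite ijE eqxx in ij.
    by have := pM _ _ (ltn_ord i) (ltn_ord j) ij'.
  by rewrite normc_distC addrC; have := pM _ _ (ltn_ord j) (ltn_ord i) ji.
(* All poles outside the closed disc; a pole inside it lies in a removed disc by assumption. *)
pose S0 : set C := [set z | 1 < normc z /\ (root q1 z || root q2 z)].
have S0out z : S0 z -> 1 < normc z by case.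
have freeM z : normc z <= 1 ->
    free_of_poles S0 (fun i => open_disc (a i) (r i)) z -> ~ covers L z.
  move=> z1 [_ zS] /LM[d /(nthP (0, 0))[i iM <-]] zd.
  exact: (zS (Ordinal iM)).
have free1 z : normc z = 1 -> free_of_poles S0 (fun i => open_disc (a i) (r i)) z.
  exact: free_circle.
have n1 z : normc z = 1 -> ~ covers L z.
  by move=> z1; apply: freeM; [rewrite z1|exact: free1].
have rfun_of (p q : {poly R[i]}) : (forall z, root q z -> root q1 z || root q2 z) ->
    (forall z, normc z <= 1 -> ~ covers L z -> ~~ root q z) ->
    rfun true [set p | ~ free_of_poles S0 (fun i => open_disc (a i) (r i)) p]
      (fun z => p.[z] / q.[z]).
  move=> qq hq; apply: rfun_fraction.
    apply/eqP => q0; have := hq 1; rewrite normc1 lexx q0 root0 => /(_ isT (n1 _ (normc1 _))).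
    by [].
  move=> z qz [nS0 nS]; have [z1|z1] := leP (normc z) 1; last by apply: nS0; split => //; exact: qq.
  by move: qz; apply/negP; apply: hq z1 (freeM _ z1 _).
have free_near (z : C) : normc z = 1 ->
    \forall w \near z, free_of_poles S0 (fun i => open_disc (a i) (r i)) w.
  move=> z1.
  have nq q : (forall z, normc z <= 1 -> ~ covers L z -> ~~ root q z) ->
      \forall w \near z, ~~ root q w.
    by move=> hq; apply: near_root; apply: hq; [rewrite z1|exact: n1].
  have far i : \forall w \near z, ~ open_disc (a i) (r i) w.
    have az : r i < normc (z - a i).
      have s0 : 0 < 1 - normc (a i) by rewrite subr_gt0.
      have := normcD (z - a i) (a i); rewrite subrK z1; have := r_small i; lra.
    apply/near_normc; exists (normc (z - a i) - r i); first by rewrite subr_gt0.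
    move=> w wz; rewrite /open_disc /= => wa.
    by have := normc_tri z w (a i); rewrite (normc_distC z w); lra.
  apply: filterS3 (nq _ h1) (nq _ h2) (@filter_forall _ _ _ _ _ far) => w w1 w2 wS.
  by split => //; case => _; rewrite (negbTE w1) (negbTE w2).
have bound (p q : {poly R[i]}) (K : R) :
    (forall z, normc z <= 1 -> ~ covers L z -> normc (p.[z] / q.[z]) <= K) ->
    forall z, normc z <= 1 -> free_of_poles S0 (fun i => open_disc (a i) (r i)) z ->
    normc (p.[z] / q.[z]) <= K.
  by move=> h z z1 zf; apply: h => //; exact: freeM.
have rf1 := rfun_of p1 q1 (fun z h => introT orP (or_introl h)) h1.
have rf2 := rfun_of p2 q2 (fun z h => introT orP (or_intror h)) h2.
have := circle_integral_bound r_gt0 r_small disj S0out free_near rf1 rf2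
  (bound _ _ _ hA) (bound _ _ _ hB).
move=> /le_trans; apply; rewrite ler_wpM2l//; last first.
  by apply: le_trans Mc; rewrite (big_nth (0, 0)) big_mkord.
have z1 := normc1 R.
have A0 : 0 <= A by apply: le_trans (hA 1 _ (n1 _ z1)); rewrite ?normc_ge0 ?z1.
have B0 : 0 <= B by apply: le_trans (hB 1 _ (n1 _ z1)); rewrite ?normc_ge0 ?z1.
by rewrite !mulr_ge0// pi_ge0.
Qed.

End merging.

(** * Compactness of the closed disc and reduction to finitely many discs *)

Section compactness.
Set Implicit Arguments.
Unset Strict Implicit.
Context {R : realType}.
Local Notation C := R[i]^o.
Implicit Types (z w : C).

Lemma compact_closed_unit_disc : compact (@closed_unit_disc R).
Proof.
pose f (x : R * R) : C := x.1 +i* x.2.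
have cf : continuous f.
  move=> [x y] A /near_normc[e e0 eA].
  have e2 : 0 < e / 2 by rewrite divr_gt0.
  exists ([set x' | `|x - x'| < e / 2], [set y' | `|y - y'| < e / 2]).
    by split; apply/nbhs_ballP; exists (e / 2).
  move=> [x' y'] /= [xx yy]; apply: eA.
  apply: le_lt_trans (normc_le_ReIm _) _; rewrite /= distrC (distrC y').
  by rewrite [ltRHS]splitr ltrD.
have cK : compact (f @` (`[-1, 1] `*` `[-1, 1])).
  apply: continuous_compact; first exact: continuous_subspaceT.
  by apply: compact_setX; exact: segment_compact.
apply: (subclosed_compact _ cK).
  rewrite -[closed_unit_disc]setCK; apply: open_closedC.
  rewrite openE => z; rewrite /closed_unit_disc /= => /negP; rewrite -ltNge => z1.
  apply/near_normc; exists (normc z - 1); first by rewrite subr_gt0.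
  move=> w wz /=; apply/negP; rewrite -ltNge.
  by have := normcD (z - w) w; rewrite subrK normc_distC; lra.
move=> z /= z1; exists (complex.Re z, complex.Im z); last by rewrite /f -complex_eta.
have := le_trans (Re_le_normc z) z1; have := le_trans (Im_le_normc z) z1.
by rewrite !ler_norml /= !in_itv.
Qed.

Lemma open_open_disc (a : C) (r : R) : open (open_disc a r).
Proof.
rewrite openE => z; rewrite /open_disc /= => za.
apply/near_normc; exists (r - normc (z - a)); first by rewrite subr_gt0.
by move=> w wz; have := normc_tri w z a; rewrite /=; lra.
Qed.

Lemma compact_unit_disc_minus (D : set (C * R)) : compact (unit_disc_minus D).
Proof.
rewrite /unit_disc_minus setDE; apply: compact_closedI.
  exact: compact_closed_unit_disc.
by apply: open_closedC; apply: bigcup_open => d _; exact: open_open_disc.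
Qed.

Lemma continuous_fraction (p q : {poly R[i]}) z : ~~ root q z ->
  {for z, continuous (fun z : C => p.[z] / q.[z] : C)}.
Proof.
move=> qz; have q0 : q != 0 by apply: contraNneq qz => ->; rewrite root0.
by apply: (continuous_rfun (rfun_fraction p q0 (S := [set z | root q z]) _)) => //; exact/negP.
Qed.

Lemma fraction_bounded (X : set C) (p q : {poly R[i]}) : compact X ->
  (forall z, X z -> ~~ root q z) ->
  exists K : R, forall z, X z -> normc (p.[z] / q.[z]) <= K.
Proof.
move=> /compact_near_coveringP cX qX.
have [|n _ hn] := cX nat \oo (fun n z => normc (p.[z] / q.[z]) <= n%:R) _.
  move=> z Xz; have := cvg_normc (@continuous_fraction p q z (qX _ Xz)) ltr01.
  move=> hz; exists ([set w : C | normc (p.[w] / q.[w] - p.[z] / q.[z]) < 1],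
    [set n | (`|Num.ceil (normc (p.[z] / q.[z]) + 1)|%N <= n)%N]).
    by split => //; exists `|Num.ceil (normc (p.[z] / q.[z]) + 1)|%N.
  move=> [w n] /= [wz zn].
  have h1 : normc (p.[z] / q.[z]) + 1 <= n%:R.
    apply: le_trans (Num.Theory.ceil_ge _) _.
    rewrite -(ler_nat R) in zn; apply: le_trans zn.
    by rewrite natr_absz ler_int ler_norm.
  have := normcD (p.[w] / q.[w] - p.[z] / q.[z]) (p.[z] / q.[z]); rewrite subrK; lra.
by exists n%:R => z Xz; exact: (hn n (leqnn n)).
Qed.

(** [sup] is an upper bound only for a bounded set; boundedness comes from compactness of [X]. *)
Lemma le_supnorm (X : set C) (p q : {poly R[i]}) z : compact X ->
  (forall z, X z -> ~~ root q z) -> X z ->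
  normc (p.[z] / q.[z]) <= supnorm X (fun z => p.[z] / q.[z]).
Proof.
move=> cX qX Xz; have [K hK] := fraction_bounded p cX qX.
apply: ub_le_sup; last by exists z.
by exists K => _ [w Xw <-]; exact: hK.
Qed.

(** [U] and the removed open discs cover the compact closed disc, so the discs of finitely many
    stages suffice. *)
Lemma finite_stage (L : nat -> seq (C * R)) (U : set C) :
  open U -> unit_disc_minus [set d | exists k, d \in L k] `<=` U ->
  exists n, forall z, normc z <= 1 -> ~ covers (flatten [seq L k | k <- iota 0 n]) z -> U z.
Proof.
move=> oU XU; have := compact_closed_unit_disc => /compact_near_coveringP cD.
have [|n _ hn] := cD nat \oo (fun n z => U z \/
    covers (flatten [seq L k | k <- iota 0 n]) z) _; last first.
  by exists n => z z1 nz; have [] := hn n (leqnn n) z z1.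
move=> z z1; have [Uz|nUz] := pselect (U z).
  exists (U, setT); first by split; [exact: open_nbhs_nbhs|exact: filterT].
  by move=> [w n] [/= Uw _]; left.
have [[d [[k dk] dz]]|nd] := pselect (exists d, (exists k, d \in L k) /\ open_disc d.1 d.2 z).
  exists (open_disc d.1 d.2, [set n | (k < n)%N]).
    split; first by apply: open_nbhs_nbhs; split => //; exact: open_open_disc.
    by exists k.+1.
  move=> [w n] [/= dw kn]; right; exists d => //.
  by apply/flatten_mapP; exists k; rewrite ?mem_iota.
by exfalso; apply: nUz; apply: XU; split => // -[d dL dz]; apply: nd; exists d.
Qed.

End compactness.

(** * The integral bound for countably many discs *)

Section integral_estimate.
Set Implicit Arguments.
Unset Strict Implicit.
Context {R : realType}.
Local Notation C := R[i]^o.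
Implicit Types (z w : C).

Lemma le_of_perturbed (x K A B : R) : 0 <= K -> 0 <= A -> 0 <= B ->
  (forall e, 0 < e -> x <= K * (A + e) * (B + e)) -> x <= K * A * B.
Proof.
move=> K0 A0 B0 h; apply/ler_addgt0Pr => e e0.
pose M := K * (A + B + 1) + 1.
have M0 : 0 < M by rewrite ltr_wpDl// mulr_ge0// !addr_ge0.
have [t [t0 t1 tM]] : exists t, [/\ 0 < t, t <= 1 & t * M <= e].
  exists (Num.min 1 (e / M)); split; first by rewrite lt_min ltr01 divr_gt0.
    by rewrite ge_min lexx.
  by rewrite -ler_pdivlMr// ge_min lexx orbT.
apply: le_trans (h t t0) _.
have -> : K * (A + t) * (B + t) = K * A * B + K * (t * (A + B + t)) by ring.
rewrite lerD2l; apply: le_trans tM; rewrite mulrCA ler_pM2l//.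
rewrite /M (le_trans (ler_wpM2l K0 (_ : _ <= A + B + 1)))//; first by rewrite lerD2l.
by rewrite lerDl.
Qed.

(** On an open set around [X] both functions are pole-free and exceed their norms by less than [e].
    That set contains the closed disc minus finitely many of the discs, so the finite bound applies;
    then [e] tends to 0. *)
Lemma integral_estimate (L : nat -> seq (C * R)) (c : R) (f g : C -> C) :
  let X := unit_disc_minus [set d | exists k, d \in L k] in
  (forall k, disc_seq (L k)) -> c <= 1 / 2 ->
  (forall n, \sum_(k < n) \sum_(d <- L k) weight d <= c) ->
  unit_circle `<=` X ->
  rational_off X f -> rational_off X g ->
  normc (circle_integral (fun z => cderiv f z * g z)) <=
    16 * pi * c * supnorm X f * supnorm X g.
Proof.
move=> X dL c2 Lc TX [p1 [q1 [h1 ->]]] [p2 [q2 [h2 ->]]].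
have cX : compact X by exact: compact_unit_disc_minus.
have X1 : X 1 by apply: TX; exact: normc1.
have A0 : 0 <= supnorm X (fun z => p1.[z] / q1.[z]).
  exact: le_trans (normc_ge0 _) (le_supnorm p1 cX h1 X1).
have B0 : 0 <= supnorm X (fun z => p2.[z] / q2.[z]).
  exact: le_trans (normc_ge0 _) (le_supnorm p2 cX h2 X1).
have c0 : 0 <= c by have := Lc 0%N; rewrite big_ord0.
apply: le_of_perturbed => //; first by rewrite !mulr_ge0// pi_ge0.
move=> e e0.
set A := supnorm X _; set B := supnorm X _.
pose U : set C := [set z | [/\ ~~ root q1 z, ~~ root q2 z,
  normc (p1.[z] / q1.[z]) < A + e & normc (p2.[z] / q2.[z]) < B + e]].
have near_lt (p q : {poly R[i]}) (K : R) z : ~~ root q z -> normc (p.[z] / q.[z]) < K ->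
    \forall w \near z, normc (p.[w] / q.[w]) < K.
  move=> qz zK; have K0 : 0 < K - normc (p.[z] / q.[z]) by rewrite subr_gt0.
  apply: filterS (cvg_normc (@continuous_fraction _ p q z qz) K0) => w.
  by have := normcD (p.[w] / q.[w] - p.[z] / q.[z]) (p.[z] / q.[z]); rewrite subrK; lra.
have oU : open U.
  rewrite openE => z [z1 z2 zA zB].
  near=> w; split.
  - by near: w; exact: near_root.
  - by near: w; exact: near_root.
  - by near: w; exact: near_lt.
  - by near: w; exact: near_lt.
have XU : X `<=` U.
  move=> z Xz; split; [exact: h1|exact: h2| |].
    by apply: le_lt_trans (le_supnorm p1 cX h1 Xz) _; rewrite ltrDl.
  by apply: le_lt_trans (le_supnorm p2 cX h2 Xz) _; rewrite ltrDl.
have [n hn] := finite_stage oU XU.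
have := @finite_discs_bound R (flatten [seq L k | k <- iota 0 n]) c (A + e) (B + e) p1 q1 p2 q2.
move=> hb; apply: le_trans (hb _ _ c2 _ _ _ _) _.
- by move=> d /flatten_mapP[k _]; exact: dL.
- rewrite big_flatten /= big_map; apply: le_trans (Lc n).
  by rewrite -(big_mkord xpredT (fun k => \sum_(d <- L k) weight d)) /index_iota subn0.
- by move=> z z1 zn; have [] := hn z z1 zn.
- by move=> z z1 zn; have [] := hn z z1 zn.
- by move=> z z1 zn; apply: ltW; have [] := hn z z1 zn.
- by move=> z z1 zn; apply: ltW; have [] := hn z z1 zn.
- by rewrite le_eqVlt; apply/orP; left; apply/eqP; ring.
Unshelve. all: by end_near. Qed.

End integral_estimate.

(** * Point derivations *)

Section point_derivations.
Set Implicit Arguments.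
Unset Strict Implicit.
Context {R : realType}.
Local Notation C := R[i]^o.
Variable X : set C.
Implicit Types (z w a : C) (p q : {poly R[i]}).

Lemma uniform_near (f : {uniform X -> C}) (P : set {uniform X -> C}) :
  (\forall g \near f, P g) -> exists2 e : R, 0 < e &
    forall g : {uniform X -> C}, (forall x : X, normc (g x - f x) < e) -> P g.
Proof.
move=> /uniform_nbhs[E [+ EP]]; rewrite -entourage_ballE => -[[e1 e2] /= e0 eE].
have [/eqP e20 e10] : e2 == 0 /\ 0 < e1 by move: e0; rewrite ltcE /= => /andP[].
exists e1 => // g fg; apply: EP => x _; apply: eE.
by rewrite /ball /= normc_norm normc_distC e20 ltcR.
Qed.

Lemma R0_ext p q (f : X -> C) : (forall z, X z -> ~~ root q z) ->
  (forall x : X, f x = p.[set_val x] / q.[set_val x]) -> R0 X f.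
Proof.
move=> qX fE; exists (fun z => p.[z] / q.[z]); first by exists p, q.
by apply/funext => x; rewrite fE.
Qed.

Lemma R0_poly p : R0 X (fun x => p.[set_val x]).
Proof.
apply: (@R0_ext p 1) => [z _|x]; first by rewrite root1.
by rewrite hornerC divr1.
Qed.

Lemma R0_inv q : (forall z, X z -> ~~ root q z) -> R0 X (fun x => q.[set_val x]^-1).
Proof. by move=> qX; apply: (@R0_ext 1 q) => // x; rewrite hornerC div1r. Qed.

Lemma R0_pole a : ~ X a -> R0 X (fun x => (set_val x - a)^-1).
Proof.
move=> Xa; suff /R0_inv : forall z, X z -> ~~ root ('X - a%:P) z.
  by under eq_fun do rewrite hornerXsubC.
by move=> z Xz; rewrite root_XsubC; apply: contra_notN Xa => /eqP <-.
Qed.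

Lemma R0_mul (f g : X -> C) : R0 X f -> R0 X g -> R0 X (fun x => f x * g x).
Proof.
move=> [F [p1 [q1 [h1 ->]]] <-] [G [p2 [q2 [h2 ->]]] <-].
apply: (@R0_ext (p1 * p2) (q1 * q2)) => [z Xz|x].
  by rewrite rootM negb_or h1// h2.
by rewrite /= !hornerM invfM mulrACA.
Qed.

Lemma R0_add (f g : X -> C) : R0 X f -> R0 X g -> R0 X (fun x => f x + g x).
Proof.
move=> [F [p1 [q1 [h1 ->]]] <-] [G [p2 [q2 [h2 ->]]] <-].
apply: (@R0_ext (p1 * q2 + p2 * q1) (q1 * q2)) => [z Xz|x].
  by rewrite rootM negb_or h1// h2.
have Xx : X (set_val x) by exact: set_valP.
rewrite /= hornerD !hornerM; apply: addf_div; [exact: h1|exact: h2].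
Qed.

Lemma R0_cst c : R0 X (fun=> c).
Proof.
have := R0_poly c%:P; by under eq_fun do rewrite hornerC.
Qed.

Lemma R0_id : R0 X set_val.
Proof. have := R0_poly 'X; by under eq_fun do rewrite hornerX. Qed.

Lemma R0_RX (f : X -> C) : R0 X f -> RX X f.
Proof.
move=> R0f; split; last exact: subset_closure.
move: R0f => [F [p [q [qX ->]]] <-] x.
apply: (@continuous_comp _ _ _ set_val (fun z : C => p.[z] / q.[z] : C)).
  exact: initial_continuous.
by apply: continuous_fraction; apply: qX; exact: set_valP.
Qed.

Variables (phi d : {uniform X -> C} -> C).
Hypothesis phiX : character_of (RX X) phi.
Hypothesis dX : point_derivation_at (RX X) phi d.

Let linear_zero psi : linear_on (RX X) psi -> psi (fun=> 0) = 0.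
Proof.
move=> lin; have r0 := R0_RX (R0_cst 0); have := lin 1 _ _ r0 r0.
under [X in psi X = _ -> _]eq_fun do rewrite mul1r addr0.
by rewrite mul1r => /eqP; rewrite -subr_eq0 opprD addrA subrr sub0r oppr_eq0 => /eqP.
Qed.

Let linear_add psi (f g : X -> C) : linear_on (RX X) psi -> RX X f -> RX X g ->
  psi (fun x => f x + g x) = psi f + psi g.
Proof.
move=> lin rf rg; have := lin 1 _ _ rf rg.
by under [X in psi X = _ -> _]eq_fun do rewrite mul1r; rewrite mul1r.
Qed.

Let linear_scale psi c (f : X -> C) : linear_on (RX X) psi -> RX X f ->
  psi (fun x => c * f x) = c * psi f.
Proof.
move=> lin rf; have := lin c _ _ rf (R0_RX (R0_cst 0)).
by under [X in psi X = _ -> _]eq_fun do rewrite addr0; rewrite linear_zero// addr0.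
Qed.

Let phi_lin : linear_on (RX X) phi. Proof. by case: phiX. Qed.
Let d_lin : linear_on (RX X) d. Proof. by case: dX. Qed.

Lemma character1 : phi (fun=> 1) = 1.
Proof.
have [_ mul [f rf f0]] := phiX; have := mul _ _ rf (R0_RX (R0_cst 1)).
under [X in phi X = _ -> _]eq_fun do rewrite mulr1.
by move=> /esym/eqP; rewrite -[X in _ == X]mulr1 (inj_eq (mulfI f0)) => /eqP.
Qed.

Lemma derivation1 : d (fun=> 1) = 0.
Proof.
have [_ der] := dX; have r1 := R0_RX (R0_cst 1); have := der _ _ r1 r1.
under [X in d X = _ -> _]eq_fun do rewrite mulr1.
rewrite character1 mul1r => /eqP; rewrite -subr_eq0 opprD addrA subrr sub0r oppr_eq0.
by move=> /eqP.
Qed.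

Let z0 : C := phi set_val.

Lemma character_cst c : phi (fun=> c) = c.
Proof.
have := @linear_scale phi c _ phi_lin (R0_RX (R0_cst 1)).
by under [X in phi X = _ -> _]eq_fun do rewrite mulr1; rewrite character1 mulr1.
Qed.

Lemma derivation_cst c : d (fun=> c) = 0.
Proof.
have := @linear_scale d c _ d_lin (R0_RX (R0_cst 1)).
by under [X in d X = _ -> _]eq_fun do rewrite mulr1; rewrite derivation1 mulr0.
Qed.

Lemma character_pole a : ~ X a -> (z0 - a) * phi (fun x => (set_val x - a)^-1) = 1.
Proof.
move=> Xa; have [_ mul _] := phiX.
have rz : RX X (fun x => set_val x + (- a)) := R0_RX (R0_add R0_id (R0_cst (- a))).
have -> : z0 - a = phi (fun x => set_val x + (- a)).
  by rewrite (linear_add phi_lin (R0_RX R0_id) (R0_RX (R0_cst _))) character_cst.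
rewrite -mul//; last exact/R0_RX/R0_pole.
rewrite -[RHS]character1; congr phi; apply/funext => x; rewrite divff//.
rewrite subr_eq0; apply/eqP => xa; apply: Xa; rewrite -xa; exact: set_valP.
Qed.

(** For [z0] off [X] the function [x - z0] would be invertible in the algebra, yet [phi] sends it to
    0. *)
Lemma character_in : X z0.
Proof.
apply: contrapT => Xz0; have := character_pole Xz0.
by rewrite subrr mul0r => /eqP; rewrite eq_sym oner_eq0.
Qed.

(** The product rule applied to (x - a) (x - a)^-1 = 1. *)
Lemma derivation_pole a : ~ X a ->
  d (fun x => (set_val x - a)^-1) = - ((z0 - a) ^+ 2)^-1 * d set_val.
Proof.
move=> Xa; have [_ der] := dX; have hp := character_pole Xa.
have za : z0 - a != 0 by apply: contra_eq_neq hp => ->; rewrite mul0r eq_sym oner_neq0.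
have pE : phi (fun x => (set_val x - a)^-1) = (z0 - a)^-1.
  by apply: (mulfI za); rewrite hp divff.
have rz : RX X (fun x => set_val x + (- a)) := R0_RX (R0_add R0_id (R0_cst (- a))).
have := der _ _ rz (R0_RX (R0_pole Xa)).
have -> : (fun x : X => (set_val x - a) * (set_val x - a)^-1) = (fun=> 1).
  apply/funext => x; rewrite divff//.
  by rewrite subr_eq0; apply/eqP => xa; apply: Xa; rewrite -xa; exact: set_valP.
rewrite derivation1 pE.
rewrite (linear_add phi_lin (R0_RX R0_id) (R0_RX (R0_cst _))) character_cst.
rewrite (linear_add d_lin (R0_RX R0_id) (R0_RX (R0_cst _))) derivation_cst addr0 -/z0.
move=> /eqP; rewrite eq_sym addr_eq0 => /eqP e.
by apply: (mulfI za); rewrite e; field.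
Qed.

Lemma derivation_poly p : phi (fun x => p.[set_val x]) = p.[z0] /\
  d (fun x => p.[set_val x]) = p^`().[z0] * d set_val.
Proof.
have [_ der] := dX; have [_ mul _] := phiX.
elim/poly_ind: p => [|p c [ihphi ihd]].
  by rewrite deriv0 !horner0 mul0r; split;
    under [X in _ X = _]eq_fun do rewrite horner0; exact: linear_zero.
have e : (fun x : X => (p * 'X + c%:P).[set_val x]) =
    (fun x => p.[set_val x] * set_val x + c) by apply/funext => x; rewrite !hornerE.
have rp := R0_RX (R0_poly p); have ri := R0_RX R0_id.
have rpi := R0_RX (R0_mul (R0_poly p) R0_id); have rc := R0_RX (R0_cst c).
rewrite e (linear_add phi_lin rpi rc) (linear_add d_lin rpi rc) mul// der//.
rewrite character_cst derivation_cst ihphi ihd -/z0 derivD derivM derivX derivC; split.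
  by rewrite !hornerE.
by rewrite !hornerE /=; ring.
Qed.

Hypothesis d_bounded : bounded_functional (RX X) d.

Lemma derivation_near (f : {uniform X -> C}) (e : R) : RX X f -> 0 < e ->
  exists2 t : R, 0 < t & forall g : {uniform X -> C}, RX X g ->
    (forall x : X, normc (g x - f x) < t) -> normc (d g - d f) < e.
Proof.
move=> rf e0; have /subspace_continuousP/(_ f rf) cd := d_bounded.
have : \forall v \near d f, normc (v - d f) < e by apply/near_normc; exists e.
move=> /cd /uniform_near[t t0 ht]; exists t => // g rg gf.
exact: ht.
Qed.

Lemma derivation_bounded : exists M : R, forall g : X -> C, R0 X g ->
  (forall x, normc (g x) <= 1) -> normc (d g) <= M.
Proof.
have [t t0 ht] := @derivation_near (fun=> 0) 1 (R0_RX (R0_cst 0)) ltr01.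
(* Scaling by [t / 2] turns the weak bound 1 into the strict bound [t] of continuity at 0; undoing
   it gives the constant [2 / t]. *)
have t2 : 0 < t / 2 by rewrite divr_gt0.
exists (2 / t) => g rg g1.
have small x : normc ((t / 2)%:C * g x - 0) < t.
  rewrite subr0 normcM normc_real gtr0_norm//.
  by apply: le_lt_trans (ler_wpM2l (ltW t2) (g1 x)) _; rewrite mulr1; lra.
have := ht (fun x => (t / 2)%:C * g x) (R0_RX (R0_mul (R0_cst _) rg)) small.
rewrite linear_zero// subr0 (linear_scale _ d_lin (R0_RX rg)) normcM normc_real gtr0_norm//.
by move=> /ltW; rewrite -ler_pdivlMl// invf_div mulr1.
Qed.

(** Continuity at [f] with tolerance |d f| would give, for a nearby [g] in [R0 X], |d f| = |d g - d
    f| < |d f|. *)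
Lemma derivation_dense : (forall g : X -> C, R0 X g -> d g = 0) ->
  forall f : X -> C, RX X f -> d f = 0.
Proof.
move=> d0 f rf; apply: contrapT => /eqP; rewrite -normc_gt0 => df.
have [t t0 ht] := derivation_near rf df.
have nf : nbhs (f : {uniform X -> C}) [set g : {uniform X -> C} | forall x : X, normc (g x - f x) < t].
  apply/uniform_nbhs; exists [set xy | ball xy.1 (t%:C) xy.2]; split.
    by rewrite -entourage_ballE; exists t%:C => //=; rewrite ltcR.
  move=> g h x; have := h x I; rewrite /ball /= normc_norm ltcR normc_distC; exact.
have [g [rg gf]] := rf.2 _ nf.
have := ht g (R0_RX rg) gf; rewrite (d0 _ rg) sub0r normcN ltxx //.
Qed.

End point_derivations.

(** * A criterion for the absence of bounded point derivations *)

Section no_derivation.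
Set Implicit Arguments.
Unset Strict Implicit.
Context {R : realType}.
Local Notation C := R[i]^o.

(* A bounded point derivation at [z] is a multiple of [f |-> f' z] on rational
   functions, hence it suffices to make [f' z] large compared to [f]. *)
Lemma no_bounded_derivation (X : set C) :
  (forall z, X z -> forall M : R, exists (p : {poly R[i]}) (s : seq (C * C)),
    [/\ forall ua, ua \in s -> ~ X ua.2,
        forall x, X x -> normc (p.[x] + \sum_(ua <- s) ua.1 * (x - ua.2)^-1) <= 1 &
        M < normc (p^`().[z] - \sum_(ua <- s) ua.1 / (z - ua.2) ^+ 2)]) ->
  no_nonzero_bounded_point_derivation (RX X).
Proof.
move=> large [phi [d [phiX dX bd [f0 rf0 df0]]]].
have [_ der] := dX; have [d_lin _] := dX.
have Xz := character_in phiX; set z := phi set_val in Xz.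
(* A derivation vanishing on the coordinate function vanishes on polynomials and, by the product
   rule, on their reciprocals; density then gives [d = 0], a contradiction. *)
have [dZ|dZ] := eqVneq (d set_val) 0.
  move/eqP: df0; apply; apply: (derivation_dense bd _ rf0) => g.
  move=> [F [p [q [qX ->]]] <-].
  have dq : d (fun x => q.[set_val x]^-1) = 0.
    have [phiq dqE] := derivation_poly phiX dX q.
    have := der _ _ (R0_RX (R0_poly X q)) (R0_RX (R0_inv qX)).
    have -> : (fun x : X => q.[set_val x] / q.[set_val x]) = (fun=> 1).
      by apply/funext => x; rewrite divff//; apply: qX; exact: set_valP.
    rewrite (derivation1 phiX dX) dqE dZ !mulr0 addr0 phiq => /esym/eqP.
    by have /negbTE qz : q.[z] != 0 := qX _ Xz; rewrite mulf_eq0 qz => /eqP.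
  have := der _ _ (R0_RX (R0_poly X p)) (R0_RX (R0_inv qX)).
  have [_ dpE] := derivation_poly phiX dX p.
  by rewrite dq dpE dZ !mulr0 addr0.
have [M hM] := derivation_bounded dX bd.
have [p [s [sX s1 sM]]] := large z Xz (M / normc (d set_val)).
have dZ0 : 0 < normc (d set_val) by rewrite normc_gt0.
suff [rs ds] : R0 X (fun x => \sum_(ua <- s) ua.1 * (set_val x - ua.2)^-1) /\
    d (fun x => \sum_(ua <- s) ua.1 * (set_val x - ua.2)^-1) =
    - (\sum_(ua <- s) ua.1 / (z - ua.2) ^+ 2) * d set_val.
  have rp := R0_poly X p; have := hM _ (R0_add rp rs).
  have -> : d (fun x => p.[set_val x] + \sum_(ua <- s) ua.1 * (set_val x - ua.2)^-1) =
      (p^`().[z] - \sum_(ua <- s) ua.1 / (z - ua.2) ^+ 2) * d set_val.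
    rewrite mulrDl -ds -(derivation_poly phiX dX p).2.
    have := d_lin 1 _ _ (R0_RX rp) (R0_RX rs).
    by under [X in d X = _ -> _]eq_fun do rewrite mul1r; rewrite mul1r.
  move=> h; have := h (fun x => s1 _ (set_valP x)); rewrite normcM.
  by move: sM; rewrite ltr_pdivrMr// => /lt_le_trans h1 /h1; rewrite ltxx.
elim: s sX {s1 sM} => [_|[u a] s ih sX].
  split; first by under eq_fun do rewrite big_nil; exact: R0_cst.
  rewrite big_nil oppr0 mul0r; under eq_fun do rewrite big_nil.
  exact: (derivation_cst phiX dX).
have [|rs ds] := ih; first by move=> ua uas; apply: sX; rewrite inE uas orbT.
have Xa : ~ X a by apply: (sX (u, a)); rewrite mem_head.
have rp := R0_pole Xa.
have -> : (fun x : X => \sum_(ua <- (u, a) :: s) ua.1 * (set_val x - ua.2)^-1) =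
    (fun x => u * (set_val x - a)^-1 + \sum_(ua <- s) ua.1 * (set_val x - ua.2)^-1).
  by apply/funext => x; rewrite big_cons.
split; first by apply: R0_add => //; apply: R0_mul => //; exact: R0_cst.
rewrite (d_lin u _ _ (R0_RX rp) (R0_RX rs)) ds (derivation_pole phiX dX Xa) -/z big_cons /=.
by ring.
Qed.

End no_derivation.

(** * The lattice construction *)

Section lattice_sums.
Set Implicit Arguments.
Unset Strict Implicit.
Context {R : realType}.
Implicit Types (p q m n j l M : nat).

(** Of the two ends of an interval of length [M], one is at distance at least [M / 2] from [x].
    Removing the index [c] there leaves an interval starting at [p']. *)
Lemma far_extreme_index (x : R) p M : exists p' c, M%:R / 2 <= `|x - c%:R| /\
  forall G : nat -> R, \sum_(j < M.+1) G (p + j)%N = G c + \sum_(j < M) G (p' + j)%N.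
Proof.
have [h|h] := leP (p%:R + M%:R / 2) x.
  exists p.+1, p; split; first by rewrite ler_normr; apply/orP; left; lra.
  move=> G; rewrite big_ord_recl /= addn0; congr (_ + _); apply: eq_bigr => j _.
  by rewrite /= /bump addSnnS.
exists p, (p + M)%N; split; last by move=> G; rewrite big_ord_recr /= addrC.
by rewrite ler_normr natrD; apply/orP; right; lra.
Qed.

(* Induction on [M], removing the extreme column and the extreme row that lie
   farther from [x] and [y]: each contributes O(K). *)
Lemma square_sum (F : nat -> nat -> R) (x y K : R) :
  (forall m n, 0 <= F m n <= 1) ->
  (forall m n, F m n * `|x - m%:R| <= K) -> (forall m n, F m n * `|y - n%:R| <= K) ->
  forall M p q, \sum_(j < M) \sum_(l < M) F (p + j)%N (q + l)%N <= 1 + 8 * K * M%:R.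
Proof.
move=> F01 Fx Fy.
have K0 : 0 <= K by apply: le_trans (Fx 0%N 0%N); rewrite mulr_ge0//; case/andP: (F01 0%N 0%N).
elim=> [|[|M] ih] p q; first by rewrite big_ord0 mulr0 addr0.
  rewrite !big_ord_recl !big_ord0 !addr0 mulr1.
  by apply: ler_wpDr; [lra|case/andP: (F01 (p + 0)%N (q + 0)%N)].
have [p' [c [xc Gp]]] := far_extreme_index x p M.+1; have [q' [e [ye Gq]]] := far_extreme_index y q M.+1.
rewrite (Gp (fun m => \sum_(l < M.+2) F m (q + l)%N)).
under [X in _ + X]eq_bigr do rewrite Gq.
rewrite big_split /=.
have M0 : 0 < M.+1%:R :> R by rewrite ltr0n.
have far (f v : R) : 0 <= f -> M.+1%:R / 2 <= v -> f * v <= K -> f <= 2 * K / M.+1%:R.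
  move=> f0 hv fv; rewrite ler_pdivlMr//.
  have := ler_wpM2l f0 hv; lra.
(* The column has M + 2 <= 2 (M + 1) entries, each at most 2 K / (M + 1). Together with the row this
   makes 8 K per step of the induction. *)
have colb : \sum_(l < M.+2) F c (q + l)%N <= 4 * K.
  apply: (@le_trans _ _ (\sum_(l < M.+2) 2 * K / M.+1%:R)).
    apply: ler_sum => l _; apply: far xc (Fx _ _).
    by case/andP: (F01 c (q + l)%N).
  rewrite sumr_const card_ord -[_ *+ M.+2]mulr_natr mulrAC ler_pdivrMr//.
  have : M.+2%:R <= 2 * M.+1%:R :> R by rewrite -natrM ler_nat; lia.
  by move=> /(ler_wpM2l K0); lra.
have rowb : \sum_(i < M.+1) F (p' + i)%N e <= 4 * K.
  apply: (@le_trans _ _ (\sum_(l < M.+1) 2 * K / M.+1%:R)).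
    apply: ler_sum => l _; apply: far ye (Fy _ _).
    by case/andP: (F01 (p' + l)%N e).
  rewrite sumr_const card_ord -[_ *+ M.+1]mulr_natr divfK ?gt_eqF//; lra.
have := ih p' q'; rewrite -[M.+2%:R]natr1; lra.
Qed.

(** For fixed [j] only the j + 1 terms with l <= j are kept; each has 2 + j + l <= 2 (j + 1), so
    they add up to at least 1 / (4 (j + 1)). *)
Lemma harmonic_square M : \sum_(j < M) (j.+1%:R)^-1 <=
  4 * \sum_(j < M) \sum_(l < M) ((2 + j + l)%:R ^+ 2)^-1 :> R.
Proof.
rewrite mulr_sumr; apply: ler_sum => j _.
apply: (@le_trans _ _ (4 * \sum_(l < M | (l < j.+1)%N) ((2 + j + l)%:R ^+ 2)^-1)); last first.
  rewrite ler_pM2l//; rewrite [leRHS](bigID (fun l : 'I_M => (l < j.+1)%N)) /=.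
  by rewrite lerDl sumr_ge0// => l _; rewrite invr_ge0 exprn_ge0.
rewrite -(big_ord_widen M (fun l => ((2 + j + l)%:R ^+ 2)^-1 : R) (ltn_ord j)).
apply: (@le_trans _ _ (4 * \sum_(l < j.+1) ((2 * j.+1)%:R ^+ 2)^-1)); last first.
  rewrite ler_pM2l//; apply: ler_sum => l _.
  rewrite lef_pV2 ?posrE ?exprn_gt0 ?ltr0n ?muln_gt0 ?addn_gt0//.
  by apply: lerXn2r; rewrite ?nnegrE// ler_nat; have := ltn_ord l; lia.
rewrite sumr_const card_ord -[_ *+ j.+1]mulr_natr natrM.
have j0 : j.+1%:R != 0 :> R by rewrite pnatr_eq0.
by rewrite le_eqVlt; apply/orP; left; apply/eqP; field.
Qed.

Lemma harmonic_unbounded (K : R) : exists M, K <= \sum_(j < M) (j.+1%:R)^-1.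
Proof.
apply: contrapT => h; apply: (@dvg_harmonic R).
apply: nondecreasing_is_cvgn.
  by apply: nondecreasing_series => i _ _; exact: harmonic_ge0.
exists K => _ [n _ <-]; rewrite /series /= big_mkord; apply/ltW.
by rewrite ltNge; apply/negP => hK; apply: h; exists n.
Qed.

End lattice_sums.

(** * One stage of lattice discs and a function with large derivative *)

Section lattice_stage.
Set Implicit Arguments.
Unset Strict Implicit.
Context {R : realType}.
Local Notation C := R[i]^o.
Implicit Types (x z : C) (N m n M : nat) (r t : R).

(** The shift by -1 - i lets the natural indices 0, ..., 2 N address the square around the unit
    disc. *)
Definition lattice N m n : C := (m%:R / N%:R - 1) +i* (n%:R / N%:R - 1).

Definition lattice_stage N r t : seq (C * R) :=
  [seq d <- [seq (lattice N m n, r) | m <- iota 0 (2 * N).+1, n <- iota 0 (2 * N).+1]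
     | normc d.1 <= 1 - t].

Lemma lattice_stageP N r t d : d \in lattice_stage N r t ->
  d.2 = r /\ normc d.1 <= 1 - t.
Proof.
by rewrite mem_filter => /andP[d1 /allpairsP[[m n] [_ _ dE]]]; split => //; rewrite dE.
Qed.

Lemma mem_lattice_stage N r t m n : (0 < N)%N -> 0 <= t ->
  normc (lattice N m n) <= 1 - t -> (lattice N m n, r) \in lattice_stage N r t.
Proof.
move=> N0 t0 mn; rewrite mem_filter [normc _ <= _]mn andTb.
have N0' : 0 < N%:R :> R by rewrite ltr0n.
have le2N k : k%:R / N%:R - 1 <= 1 - t -> (k < (2 * N).+1)%N.
  rewrite ltnS lerBlDr ler_pdivrMr// => h; rewrite -(ler_nat R) natrM.
  by apply: le_trans h _; rewrite ler_pM2r//; lra.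
apply/allpairsP; exists (m, n); split=> [||//]; rewrite mem_iota add0n leq0n andTb; apply: le2N.
  by apply: le_trans mn; apply: le_trans (ler_norm _) (Re_le_normc (lattice N m n)).
by apply: le_trans mn; apply: le_trans (ler_norm _) (Im_le_normc (lattice N m n)).
Qed.

(** There are at most (2 N + 1)^2 <= 9 N^2 centres, each at distance at least [t] from the
    circle. *)
Lemma weight_lattice_stage N r t : (0 < N)%N -> 0 < t -> 0 <= r ->
  \sum_(d <- lattice_stage N r t) weight d <= 9 * N%:R ^+ 2 * r / t ^+ 2.
Proof.
move=> N0 t0 r0.
apply: (@le_trans _ _ (\sum_(d <- lattice_stage N r t) r / t ^+ 2)).
  rewrite big_seq [leRHS]big_seq; apply: ler_sum => d /lattice_stageP[dr dt].
  have td : t <= 1 - normc d.1 by lra.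
  rewrite /weight dr ler_wpM2l// lef_pV2 ?posrE ?exprn_gt0//; last exact: lt_le_trans td.
  by apply: lerXn2r; rewrite ?nnegrE ?(ltW t0)// (le_trans _ td) ?ltW.
rewrite big_const_seq count_predT iter_addr_0 -[_ *+ size _]mulr_natr.
rewrite -[9 * _ * r / _]mulrA [leRHS]mulrC.
rewrite ler_wpM2l ?divr_ge0 ?exprn_ge0 ?(ltW t0)//.
rewrite -natrX -natrM ler_nat; apply: leq_trans (_ : (2 * N).+1 * (2 * N).+1 <= _)%N.
  rewrite size_filter; apply: leq_trans (count_size _ _) _.
  by rewrite size_allpairs !size_iota.
by rewrite -mulnn; nia.
Qed.

(** The sum runs over an M x M block of lattice points starting at the lattice cell of [z]. At [z]
    the phases align all terms of the derivative, which grows like log M; the sum itself is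
    controlled on [X] by [square_sum], whatever the phases. *)
Lemma large_derivative N M r t z (X : set C) :
  (0 < N)%N -> (0 < M)%N -> 0 < r -> 0 <= t -> X z -> normc z <= 1 - t - 2 * M%:R / N%:R ->
  (forall x, X x -> normc x <= 1) ->
  (forall d, d \in lattice_stage N r t -> forall x, X x -> ~ open_disc d.1 d.2 x) ->
  exists s : seq (C * C),
    [/\ forall ua, ua \in s -> ~ X ua.2,
        forall x, X x -> normc (\sum_(ua <- s) ua.1 * (x - ua.2)^-1) <= 1 + 8 * (r * N%:R) * M%:R &
        r * N%:R ^+ 2 / 4 * \sum_(j < M) (j.+1%:R)^-1 <=
          normc (\sum_(ua <- s) ua.1 / (z - ua.2) ^+ 2)].
Proof.
move=> N0 M0 r0 t0 Xz z1 X1 XD.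
have N0' : 0 < N%:R :> R by rewrite ltr0n.
have corner (v : R) : 0 <= v -> exists p : nat, p%:R / N%:R <= v <= (p%:R + 1) / N%:R.
  move=> v0; exists (Num.truncn (v * N%:R)).
  have := Num.Theory.truncn_itv (mulr_ge0 v0 (ltW N0')).
  by rewrite ler_pdivrMr// ler_pdivlMr// natr1 => /andP[-> /ltW ->].
have z1' : normc z <= 1 by exact: X1.
have [p /andP[p1 p2]] : exists p : nat, p%:R / N%:R <= complex.Re z + 1 <= (p%:R + 1) / N%:R.
  by apply: corner; have := le_trans (Re_le_normc z) z1'; rewrite ler_norml; lra.
have [q /andP[q1 q2]] : exists q : nat, q%:R / N%:R <= complex.Im z + 1 <= (q%:R + 1) / N%:R.
  by apply: corner; have := le_trans (Im_le_normc z) z1'; rewrite ler_norml; lra.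
pose a (j l : nat) : C := lattice N (p + j) (q + l).
have za j l : normc (z - a j l) <= (2 + j + l)%:R / N%:R.
  apply: le_trans (normc_le_ReIm _) _; rewrite Re_add Im_add /=.
  have hr : `|complex.Re z - ((p + j)%:R / N%:R - 1)| <= (1 + j)%:R / N%:R.
    rewrite ler_norml !natrD !mulrDl; rewrite !mulrDl in p2.
    have : 0 <= j%:R / N%:R :> R by rewrite divr_ge0.
    have : 0 <= N%:R^-1 :> R by rewrite invr_ge0.
    by move=> ? ?; apply/andP; split; lra.
  have hi : `|complex.Im z - ((q + l)%:R / N%:R - 1)| <= (1 + l)%:R / N%:R.
    rewrite ler_norml !natrD !mulrDl; rewrite !mulrDl in q2.
    have : 0 <= l%:R / N%:R :> R by rewrite divr_ge0.
    have : 0 <= N%:R^-1 :> R by rewrite invr_ge0.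
    by move=> ? ?; apply/andP; split; lra.
  apply: le_trans (lerD hr hi) _; rewrite -mulrDl -natrD.
  by rewrite (_ : (1 + j + (1 + l) = 2 + j + l)%N)//; lia.
(* The block lies within 2 M / N of [z], so the margin in the hypothesis on |z| keeps all its
   centres in the stage. *)
have amem (j l : 'I_M) : (a j l, r) \in lattice_stage N r t.
  apply: mem_lattice_stage => //; rewrite -/(a j l).
  have h1 : normc (a j l) <= normc z + normc (z - a j l).
    by rewrite normc_distC -{1}(subrK z (a j l)) addrC normcD.
  have h2 : (2 + j + l)%:R / N%:R <= 2 * M%:R / N%:R :> R.
    rewrite ler_pM2r ?invr_gt0// -natrM ler_nat.
    by have := ltn_ord j; have := ltn_ord l; lia.
  by have := za j l; lra.
have aX (j l : 'I_M) : ~ X (a j l).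
  move=> Xa; apply: (XD _ (amem j l) _ Xa).
  suff : normc (a j l - a j l) < r by [].
  by rewrite subrr normc0.
have zan (j l : 'I_M) : z - a j l != 0.
  by rewrite subr_eq0; apply/eqP => e; apply: (aX j l); rewrite -e.
(* Of modulus [r], with the phase that makes u / (z - a)^2 equal to the positive number r / |z -
   a|^2. *)
pose u (j l : nat) : C := r%:C * (z - a j l) ^+ 2 / (normc (z - a j l) ^+ 2)%:C.
have nu (j l : 'I_M) : normc (u j l) = r.
  rewrite /u normcM normcM normcV normcX !normc_real (ger0_norm (sqr_ge0 _)) gtr0_norm//.
  by rewrite mulfK// expf_neq0// normc_eq0.
exists [seq (u jl.1 jl.2, a jl.1 jl.2) | jl : 'I_M * 'I_M <- enum {: 'I_M * 'I_M}].
have sumE (G : C * C -> C) :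
    \sum_(ua <- [seq (u jl.1 jl.2, a jl.1 jl.2) | jl : 'I_M * 'I_M <- enum {: 'I_M * 'I_M}]) G ua =
    \sum_(j < M) \sum_(l < M) G (u j l, a j l).
  by rewrite big_map big_enum /= pair_bigA.
split.
- by move=> ua /mapP[[j l] _ ->] /=; exact: aX.
- move=> x Xx; rewrite sumE /=.
  (* The moduli of the terms, extended by 0 to indices outside the stage so that the bounds required
     by [square_sum] hold for all indices. *)
  pose F m n : R := if (lattice N m n, r) \in lattice_stage N r t
    then r / normc (x - lattice N m n) else 0.
  have rx m n : (lattice N m n, r) \in lattice_stage N r t -> r <= normc (x - lattice N m n).
    by move=> /XD/(_ x Xx) /= /negP; rewrite -leNgt.
  have Fs m n (v : R) : `|v| <= N%:R * normc (x - lattice N m n) -> F m n * `|v| <= r * N%:R.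
    move=> hv; rewrite /F; case: ifPn => [/rx rm|_]; last by rewrite mul0r mulr_ge0 ?ltW.
    have n0 : 0 < normc (x - lattice N m n) by exact: lt_le_trans rm.
    by rewrite mulrAC ler_pdivrMr// -mulrA ler_pM2l.
  (* The point [x] is expressed in lattice units, where a coordinate offset is at most N |x - a|;
     hence [K = r * N]. *)
  apply: le_trans (@square_sum _ F ((complex.Re x + 1) * N%:R) ((complex.Im x + 1) * N%:R) (r * N%:R) _ _ _ M p q).
  + elim/big_ind2: _ => [|x1 x2 y1 y2 h1 h2|j _]; first by rewrite normc0.
      by apply: le_trans (normcD _ _) _; exact: lerD.
    elim/big_ind2: _ => [|x1 x2 y1 y2 h1 h2|l _]; first by rewrite normc0.
      by apply: le_trans (normcD _ _) _; exact: lerD.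
    by rewrite normcM nu normcV /F -/(a j l) amem.
  + move=> m n; rewrite /F; case: ifPn => [/rx rm|_]; last by rewrite lexx ler01.
    have n0 : 0 < normc (x - lattice N m n) by exact: lt_le_trans rm.
    by rewrite divr_ge0 ?(ltW r0) ?(ltW n0)//= ler_pdivrMr// mul1r.
  + move=> m n; apply: Fs.
    have -> : (complex.Re x + 1) * N%:R - m%:R = N%:R * complex.Re (x - lattice N m n).
      by rewrite Re_add /=; field; rewrite gt_eqF.
    by rewrite normrM ger0_norm// ler_pM2l//; exact: Re_le_normc.
  + move=> m n; apply: Fs.
    have -> : (complex.Im x + 1) * N%:R - n%:R = N%:R * complex.Im (x - lattice N m n).
      by rewrite Im_add /=; field; rewrite gt_eqF.
    by rewrite normrM ger0_norm// ler_pM2l//; exact: Im_le_normc.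
- rewrite sumE /=.
  have -> : \sum_(j < M) \sum_(l < M) u j l / (z - a j l) ^+ 2 =
      (\sum_(j < M) \sum_(l < M) r / normc (z - a j l) ^+ 2)%:C.
    rewrite rmorph_sum; apply: eq_bigr => j _; rewrite rmorph_sum; apply: eq_bigr => l _.
    have n0 : (normc (z - a j l) ^+ 2)%:C != 0 :> C.
      by rewrite (inj_eq (@complexI _)) expf_neq0// normc_eq0.
    rewrite /= rmorphM fmorphV /u mulrAC; congr (_ / _).
    by rewrite mulfK// expf_neq0.
  rewrite normc_real; apply: le_trans (ler_norm _).
  apply: (@le_trans _ _ (r * N%:R ^+ 2 * \sum_(j < M) \sum_(l < M) ((2 + j + l)%:R ^+ 2)^-1)).
    rewrite -[_ / 4 * _]mulrA ler_pM2l ?mulr_gt0 ?exprn_gt0// ler_pdivrMl//; exact: harmonic_square.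
  rewrite mulr_sumr; apply: ler_sum => j _; rewrite mulr_sumr; apply: ler_sum => l _.
  rewrite -mulrA ler_pM2l// -[N%:R ^+ 2]invrK -invfM lef_pV2 ?posrE.
  + by rewrite mulrC -exprVn -exprMn; apply: lerXn2r; rewrite ?nnegrE ?normc_ge0 ?divr_ge0 ?za.
  + by apply: mulr_gt0; [rewrite invr_gt0 exprn_gt0|rewrite exprn_gt0// ltr0n].
  + by rewrite exprn_gt0// normc_gt0.
Qed.

End lattice_stage.

(** * Peaking polynomials and the choice of the stages *)

Section construction.
Set Implicit Arguments.
Unset Strict Implicit.
Context {R : realType}.
Local Notation C := R[i]^o.

(** With [h] the mean of [1] and [conj(z) x], one has |h| <= 1 on the disc, h(z) = 1 and |h'(z)| =
    1/2, so the n-th power has derivative of modulus n / 2 at [z]. *)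
Lemma peak_polynomial (z : C) (M : R) : normc z = 1 -> exists p : {poly R[i]},
  (forall x, normc x <= 1 -> normc p.[x] <= 1) /\ M < normc p^`().[z].
Proof.
move=> z1; pose n := Num.bound (2 * `|M|).
have nM : 2 * `|M| < n%:R by apply: Num.Theory.archi_boundP; rewrite mulr_ge0.
pose b : R[i] := (z^*)%C / 2.
have nb : normc b = 1 / 2.
  rewrite normcM normc_conjC z1 normcV; congr (_ / _).
  by rewrite -(normr_nat R 2) -normc_real rmorph_nat.
have hb : normc (2^-1 : R[i]) = 1 / 2.
  by rewrite normcV div1r -(normr_nat R 2) -normc_real rmorph_nat.
pose h : {poly R[i]} := b *: 'X + (2^-1)%:P.
have hz : h.[z] = 1.
  by rewrite !hornerE /b mulrAC [_ * z]mulrC -normc_conj z1 expr1n; field.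
exists (h ^+ n); split.
  move=> x x1; rewrite horner_exp normcX exprn_ile1 ?normc_ge0// !hornerE.
  apply: le_trans (normcD _ _) _; rewrite normcM nb hb; lra.
rewrite deriv_exp hornerMn hornerM horner_exp hz expr1n mulr1.
have -> : h^`().[z] = b by rewrite derivD derivZ derivX derivC !hornerE.
by rewrite normcMn nb -mulr_natr; have := ler_norm M; lra.
Qed.

Lemma half_power_le (k : nat) : (1 / 2 : R) ^+ k <= k.+1%:R^-1.
Proof.
rewrite expr_div_n expr1n div1r lef_pV2 ?posrE ?exprn_gt0 ?ltr0n//.
by rewrite -natrX ler_nat ltn_expl.
Qed.

Lemma half_power_sum (n : nat) : \sum_(k < n) (1 / 2 : R) ^+ k.+1 = 1 - (1 / 2) ^+ n.
Proof.
elim: n => [|n ih]; first by rewrite big_ord0 expr0 subrr.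
by rewrite big_ord_recr ih /= [_ ^+ n.+1]exprS; lra.
Qed.

End construction.

Theorem theorem1p1 (R : realType) (C : R) (hC : 0 < C) :
  exists X : set R[i]^o,
    [/\ compact X,
        exists D : set (R[i]^o * R),
          [/\ countable D, forall d, D d -> 0 < d.2 & X = unit_disc_minus D],
        unit_circle `<=` X,
        no_nonzero_bounded_point_derivation (RX X) &
        forall f g : R[i]^o -> R[i]^o, rational_off X f -> rational_off X g ->
          normc (circle_integral (fun z => cderiv f z * g z))
            <= C * supnorm X f * supnorm X g].
Proof.
have pi0 : 0 < pi :> R := pi_gt0 R.
(* The budget for the total weight: the first entry yields the constant [C], the second keeps merged
   discs away from the circle. *)
pose c : R := Num.min (C / (16 * pi)) (1 / 2).
have c0 : 0 < c by rewrite lt_min divr_gt0 ?mulr_gt0//=; lra.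
have c2 : c <= 1 / 2 by rewrite ge_min lexx orbT.
have cC : 16 * pi * c <= C by rewrite -ler_pdivlMl ?mulr_gt0// mulrC ge_min lexx.
pose t k : R := (1 / 2) ^+ k.
have t0 k : 0 < t k by rewrite exprn_gt0.
have t1 k : t k <= 1 by rewrite exprn_ile1//; lra.
(* The factor [t k ^+ 2 / 9] cancels the constants of [weight_lattice_stage], so stage [k] has
   weight at most c / 2^(k+1). *)
pose eps k := c * (1 / 2) ^+ k.+1 * t k ^+ 2 / 9.
have eps0 k : 0 < eps k by rewrite divr_gt0// !mulr_gt0// exprn_gt0.
have epst k : eps k <= t k.
  have h : (1 / 2 : R) ^+ k.+1 <= 1 by rewrite exprn_ile1//; lra.
  have h0 : 0 < (1 / 2 : R) ^+ k.+1 by rewrite exprn_gt0.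
  have e1 : c * (1 / 2) ^+ k.+1 <= 1 by nra.
  have e2 : t k ^+ 2 <= t k by have := t0 k; have := t1 k; nra.
  have e3 : 0 < c * (1 / 2) ^+ k.+1 by rewrite mulr_gt0.
  have e4 : 0 < t k ^+ 2 by rewrite exprn_gt0.
  by rewrite /eps ler_pdivrMr//; have := t0 k; nra.
(* Blocks so large that [eps k] times the harmonic sum is at least k + 1, although [eps k] is
   tiny. *)
have [M hM] : {M : nat -> nat & forall k,
    k.+1%:R / eps k <= \sum_(j < M k) (j.+1%:R)^-1}.
  apply: (@choice _ _ (fun k M => k.+1%:R / eps k <= \sum_(j < M) (j.+1%:R)^-1)) => k.
  exact: harmonic_unbounded.
have M0 k : (0 < M k)%N.
  rewrite lt0n; apply/eqP => Mk; have := hM k; rewrite Mk big_ord0 leNgt.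
  by rewrite divr_gt0.
(* The mesh is chosen so that a block of [M k] points has side [t k]. *)
pose N k := (M k * 2 ^ k)%N.
have N0 k : (0 < N k)%N by rewrite muln_gt0 M0 expn_gt0.
have N0' k : 0 < (N k)%:R :> R by rewrite ltr0n.
have MN k : (M k)%:R / (N k)%:R = t k.
  have ? : (M k)%:R != 0 :> R by rewrite pnatr_eq0 -lt0n.
  have ? : 2 ^+ k != 0 :> R by rewrite expf_neq0.
  by rewrite natrM natrX /t expr_div_n expr1n; field; apply/andP.
pose r k : R := eps k / (N k)%:R ^+ 2.
have r0 k : 0 < r k by rewrite divr_gt0// exprn_gt0.
have rt k : r k <= t k.
  apply: le_trans (epst k); rewrite ler_pdivrMr ?exprn_gt0// ler_peMr ?(ltW (eps0 k))//.
  by rewrite -natrX ler1n expn_gt0 N0.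
pose L k := lattice_stage (N k) (r k) (t k).
have LP k d : d \in L k -> d.2 = r k /\ normc d.1 <= 1 - t k by exact: lattice_stageP.
pose D : set (R[i]^o * R) := [set d | exists k, d \in L k].
pose X := unit_disc_minus D.
have dL k : disc_seq (L k).
  by move=> d /LP[-> d1]; split; [exact: r0|have := t0 k; lra].
have sL n : \sum_(k < n) \sum_(d <- L k) weight d <= c.
  apply: (@le_trans _ _ (\sum_(k < n) c * (1 / 2) ^+ k.+1)).
    apply: ler_sum => k _; apply: le_trans (weight_lattice_stage (N0 k) (t0 k) (ltW (r0 k))) _.
    have ? : (N k)%:R != 0 :> R by rewrite gt_eqF.
    have ? : t k != 0 by rewrite gt_eqF.
    rewrite le_eqVlt; apply/orP; left; apply/eqP; rewrite /r /eps.
    by field; apply/andP.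
  by rewrite -mulr_sumr half_power_sum ler_piMr ?(ltW c0)// gerBl exprn_ge0.
have TX : @unit_circle R `<=` X.
  move=> z z1; split; first by rewrite /closed_unit_disc /= z1.
  move=> [d [k /LP[dr dt]]]; rewrite /open_disc /= dr.
  by have := normcD (z - d.1) d.1; rewrite subrK z1; have := rt k; lra.
have XD k d : d \in L k -> forall x, X x -> ~ open_disc d.1 d.2 x.
  by move=> dk x [_ nx] xd; apply: nx; exists d => //; exists k.
have X1 x : X x -> normc x <= 1 by case.
exists X; split => //.
- exact: compact_unit_disc_minus.
- exists D; split => //; last by move=> d [k /LP[-> _]].
  have -> : D = \bigcup_k [set` L k] by apply/seteqP; split => [d [k dk]|d [k _ dk]]; exists k.
  apply: bigcup_countable => // k _; exact/finite_set_countable/finite_seq.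
- apply: no_bounded_derivation => z Xz K.
  have [z1|z1] := eqVneq (normc z) 1.
    have [p [p1 pK]] := peak_polynomial K z1; exists p, [::]; split => //.
      by move=> x /X1 x1; rewrite big_nil addr0 p1.
    by rewrite big_nil subr0.
  have {}z1 : normc z < 1 by rewrite lt_neqAle z1 X1.
  have z0 : 0 < 1 - normc z by rewrite subr_gt0.
  (* The first summand gives 3 t_k <= 1 - |z|, room for the margin t_k and a block of extent 2 t_k.
     In the second, 36 = 4 * 9 makes up for the factor 1/4 in the derivative bound and for the
     normalisation by 9. *)
  pose k := Num.bound (3 / (1 - normc z) + 36 * `|K|).
  have kb : 3 / (1 - normc z) + 36 * `|K| < k%:R.
    by apply: Num.Theory.archi_boundP; apply: addr_ge0; [rewrite divr_ge0// ltW|rewrite mulr_ge0].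
  have k1 : k%:R < k.+1%:R :> R by rewrite ltr_nat.
  have k0 : 0 < k.+1%:R :> R by rewrite ltr0n.
  have zk : 3 * t k <= 1 - normc z.
    have h1 : 3 < k.+1%:R * (1 - normc z).
      rewrite -ltr_pdivrMr//; have := normr_ge0 K; lra.
    have h2 : t k * k.+1%:R <= 1 by rewrite -ler_pdivlMr// div1r half_power_le.
    have := t0 k; nra.
  have zM : normc z <= 1 - t k - 2 * (M k)%:R / (N k)%:R.
    by rewrite -mulrA MN; lra.
  have [s [sX sb sd]] := large_derivative (N0 k) (M0 k) (r0 k) (ltW (t0 k)) Xz zM X1 (XD k).
  (* Division by 9 normalises the sum, whose bound is 1 + 8 r N M = 1 + 8 eps_k t_k <= 9. *)
  exists 0, [seq (ua.1 / 9, ua.2) | ua <- s]; split.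
  + by move=> _ /mapP[ua /sX uaX ->].
  + move=> x Xx; rewrite horner0 add0r big_map /=.
    under eq_bigr do rewrite mulrAC.
    rewrite -mulr_suml normcM normcV.
    have -> : normc (9 : R[i]) = 9 by rewrite -(rmorph_nat (real_complex R)) normc_real normr_nat.
    rewrite ler_pdivrMr// mul1r; apply: le_trans (sb x Xx) _.
    have e : r k * (N k)%:R * (M k)%:R = eps k * t k.
      have ? : (N k)%:R != 0 :> R by rewrite gt_eqF.
      by rewrite -MN /r; field.
    rewrite -[8 * _ * _]mulrA e.
    by have := epst k; have := t1 k; have := t0 k; have := eps0 k; nra.
  + rewrite deriv0 horner0 sub0r normcN big_map /=.
    under eq_bigr do rewrite mulrAC.
    rewrite -mulr_suml normcM normcV.
    have -> : normc (9 : R[i]) = 9 by rewrite -(rmorph_nat (real_complex R)) normc_real normr_nat.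
    rewrite ltr_pdivlMr//; apply: lt_le_trans sd.
    have -> : r k * (N k)%:R ^+ 2 = eps k by rewrite /r divfK// expf_neq0// gt_eqF.
    have := hM k; rewrite ler_pdivrMr// => h.
    have := ler_norm K; have : 0 < 3 / (1 - normc z) by rewrite divr_gt0.
    lra.
- move=> f g rf rg.
  have := integral_estimate dL c2 sL TX rf rg; rewrite -/D -/X => /le_trans; apply.
  have sup0 (h : R[i]^o -> R[i]^o) : rational_off X h -> 0 <= supnorm X h.
    move=> [p [q [qX ->]]]; have X_1 : X 1 by apply: TX; exact: normc1.
    apply: le_trans (normc_ge0 _) (le_supnorm p _ qX X_1).
    exact: compact_unit_disc_minus.
  by rewrite -!mulrA [leRHS]mulrA !mulrA !ler_wpM2r ?sup0.
Qed.
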